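(* Let $I=\langle x^{a_i}y^{b_i}\mid 0\le i\le r\rangle$ be a monomial ideal of $R$ with $r\ge 2$, $a_0>a_1>\dots>a_{r-1}>a_r=0$, $b_0=0<b_1<\dots<b_{r-1}<b_r$ and $a_0\le b_r$, and assume that $I$ is complete. Let $2\le e\le r$ be an integer satisfying $a_{r-e+2}=e-2$. If either (1) $r\ge e+1$, or (2) $r=e$, $x^{r-1}y\notin I$ and $x^r\in I$ is satisfied, then the associated module $M=M(I;e)$ is an indecomposable integrally closed $R$-module of rank $e$ with $I(M)=I$.
   Context: $(R,\mathfrak m)$ is a two-dimensional regular local ring with infinite residue field, and $x,y$ is a fixed regular system of parameters, $\mathfrak m=\langle x,y\rangle$. An ideal is complete if it is integrally closed. The module $M(I;e)$: for $I$ as in the claim and $2\le e\le r$, put $a_i'=a_i-e+1$ for $0\le i\le r-e+1$ and $c_i=b_{r-e+1+i}-i$ for $1\le i\le e-1$. Let $\epsilon_1,\dots,\epsilon_e$ be the standard basis of $R^e$. Then $M(I;e)\subset F:=R^e$ is the submodule generated by $f_i=x^{a_i'}y^{b_i}\epsilon_1$ for $0\le i\le r-e+1$, $g_i=y\,\epsilon_i+x\,\epsilon_{i+1}$ for $1\le i\le e-1$, $h_i=y^{c_i}\epsilon_{i+1}$ for $1\le i\le e-1$. For a finitely generated torsion-free $R$-module $M$, the double dual $M^{**}$ is free and contains $M$ with finite-length quotient; $I(M)=\operatorname{Fitt}_0(M^{**}/M)$. (For $M=M(I;e)$ one has $M^{**}=R^e$, so $I(M)$ is the ideal generated by the maximal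 minors of the matrix whose columns are $f_0,\dots,f_{r-e+1},g_1,\dots,g_{e-1},h_1,\dots,h_{e-1}$.) Integral closure of modules (Rees): with $K$ the fraction field of $R$, $M_K=M\otimes_R K$, and $MV$ the image of $M\otimes_R V\to M_K$ for $R\subset V\subset K$, set $\overline M=\{f\in M_K\mid f\in MV$ for every discrete valuation ring $V$ with $R\subset V\subset K\}$; $M$ is integrally closed if $\overline M=M$. *)

(* Defs.v *)
From HB Require Import structures.
From mathcomp Require Import all_boot all_order all_algebra ring_quotient.
From mathcomp Require Import all_classical.

Set Implicit Arguments.
Unset Strict Implicit.
Unset Printing Implicit Defensive.

Import GRing.Theory.

Local Open Scope classical_set_scope.
Local Open Scope ring_scope.

(* [lincomb A G]: finite sums of c *: u with c in A and u in G.  When A is a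
   subring it is the A-submodule generated by G. *)
Definition lincomb (R : pzRingType) (U : lmodType R) (A : set R) (G : set U) :
    set U :=
  [set v | exists n (c : 'I_n -> R) (u : 'I_n -> U),
     (forall i, A (c i) /\ G (u i)) /\ v = \sum_(i < n) c i *: u i].

Section Span.
Context (R : pzRingType) (U : lmodType R) (G : set U).

Definition span : {pred U} := fun v => `[< lincomb setT G v >].

Lemma span_submod_closed : submod_closed span.
Proof.
split; first by apply/asboolP; exists 0, (fun=> 0), (fun=> 0); split;
  [case | rewrite big_ord0].
move=> a u v /asboolP [n [c [s [Gs ->]]]] /asboolP [m [d [t [Gt ->]]]].
apply/asboolP; exists (n + m)%N.
exists (fun k : 'I_(n + m) => match fintype.split k with inl i => a * c i | inr j => d j end).
exists (fun k : 'I_(n + m) => match fintype.split k with inl i => s i | inr j => t j end).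
split=> [k|]; first by split=> //; case: (fintype.split k) => i;
  [case: (Gs i) | case: (Gt i)].
rewrite big_split_ord /= scaler_sumr; congr (_ + _); apply: eq_bigr => i _.
  by rewrite (unsplitK (inl i)) scalerA.
by rewrite (unsplitK (inr i)).
Qed.

HB.instance Definition _ :=
  GRing.isSubmodClosed.Build R U span
    (GRing.submod_closed_semi span_submod_closed).

End Span.

Notation gen_ideal R G := (@span R R^o G).

Definition noetherian (R : comNzRingType) : Prop :=
  forall J : submodClosed R^o,
    exists s : seq R, J =i gen_ideal R [set` s].

Definition has_prime_chain (R : comNzRingType) (n : nat) : Prop :=
  exists P : nat -> prime_idealr R,
    forall i, (i < n)%N -> [set` P i] `<` [set` P i.+1].

Definition krull_dim (R : comNzRingType) (n : nat) : Prop :=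
  has_prime_chain R n /\ ~ has_prime_chain R n.+1.

Definition local_ring (R : comUnitRingType) (m : idealr R) : Prop :=
  forall a, (a \in m) = (a \isn't a GRing.unit).

(* [x, y] is then a regular system of parameters. *)
Definition regular_local_ring2 (R : comUnitRingType) (m : idealr R) (x y : R) :
    Prop :=
  [/\ noetherian R, local_ring m, krull_dim R 2 & m =i gen_ideal R [set x; y]].

Definition infinite_residue_field (R : comUnitRingType) (m : idealr R) : Prop :=
  infinite_set [set: {ideal_quot m}].

Definition ideal_exp (R : comNzRingType) (I : {pred R}) (n : nat) : {pred R} :=
  gen_ideal R [set \prod_(i < n) u i | u in [set u | forall i, u i \in I]].

Definition integral_over_ideal (R : comNzRingType) (I : {pred R}) (z : R) :
    Prop :=
  exists n (c : nat -> R),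
    [/\ (0 < n)%N, forall i, (1 <= i <= n)%N -> c i \in ideal_exp I i
      & z ^+ n + \sum_(1 <= i < n.+1) c i * z ^+ (n - i) = 0].

Definition complete_ideal (R : comNzRingType) (I : {pred R}) : Prop :=
  forall z, z \in I <-> integral_over_ideal I z.

Section SubmoduleType.
Context (R : pzRingType) (U : lmodType R) (S : submodClosed U).

Record submod_type := SubmodType {
  submod_val : U;
  submod_valP : submod_val \in S }.

HB.instance Definition _ := [isSub for submod_val].
HB.instance Definition _ := [Choice of submod_type by <:].
HB.instance Definition _ := [SubChoice_isSubLmodule of submod_type by <:].

End SubmoduleType.

Section Dual.
Context (R : comNzRingType) (M : lmodType R).

Definition dual : Type := {linear M -> R^o}.

Definition dual_fun (f : dual) : {linear M -> R^o} := f.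

HB.instance Definition _ := gen_eqMixin dual.
HB.instance Definition _ := gen_choiceMixin dual.

Definition dual_zero : dual := \0.
Definition dual_opp (f : dual) : dual := \- dual_fun f.
Definition dual_add (f g : dual) : dual := dual_fun f \+ dual_fun g.
Definition dual_scale (a : R) (f : dual) : dual := a \*: dual_fun f.

Lemma dualP (f g : dual) : dual_fun f =1 dual_fun g -> f = g.
Proof.
case: f g => [f [[fA] [fZ]]] [g [[gA] [gZ]]] /= /funext fg; subst g.
by congr (GRing.Linear.Pack (GRing.Linear.Class _ _));
  [congr GRing.isNmodMorphism.phant_Build | congr GRing.isScalable.phant_Build];
  apply: Prop_irrelevance.
Qed.

Lemma dual_addA : associative dual_add.
Proof. by move=> f g h; apply: dualP => v; apply: addrA. Qed.
Lemma dual_addC : commutative dual_add.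
Proof. by move=> f g; apply: dualP => v; apply: addrC. Qed.
Lemma dual_add0 : left_id dual_zero dual_add.
Proof. by move=> f; apply: dualP => v; apply: add0r. Qed.
Lemma dual_addN : left_inverse dual_zero dual_opp dual_add.
Proof. by move=> f; apply: dualP => v; apply: addNr. Qed.

HB.instance Definition _ :=
  GRing.isZmodule.Build dual dual_addA dual_addC dual_add0 dual_addN.

Lemma dual_scaleA a b f :
  dual_scale a (dual_scale b f) = dual_scale (a * b) f.
Proof. by apply: dualP => v; apply: mulrA. Qed.
Lemma dual_scale1 : left_id 1 dual_scale.
Proof. by move=> f; apply: dualP => v; apply: mul1r. Qed.
Lemma dual_scaleDr : right_distributive dual_scale +%R.
Proof. by move=> a f g; apply: dualP => v; apply: mulrDr. Qed.
Lemma dual_scaleDl f : {morph dual_scale^~ f : a b / a + b}.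
Proof. by move=> a b; apply: dualP => v; apply: mulrDl. Qed.

HB.instance Definition _ := GRing.Zmodule_isLmodule.Build R dual
  dual_scaleA dual_scale1 dual_scaleDr dual_scaleDl.

End Dual.

Section DoubleDual.
Context (R : comNzRingType) (M : lmodType R).

Definition dual_eval (v : M) (f : dual M) : R^o := dual_fun f v.

Lemma dual_eval_linear v : linear (dual_eval v).
Proof. by []. Qed.

HB.instance Definition _ v :=
  GRing.isLinear.Build R (dual M) R^o *:%R (dual_eval v) (dual_eval_linear v).

Definition to_double_dual (v : M) : dual (dual M) :=
  (dual_eval v : {linear dual M -> R^o}).

End DoubleDual.

(* [fitting0 S] is Fitt_0(N/S), for a submodule S of N such that N/S is finitely
   generated: [u] is a family generating N modulo S, and the rows of [A] are
   relations between the classes of the [u i].  By Fitting's lemma the ideal of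
   maximal minors is the same for all [u]. *)
Definition generates_mod (R : comNzRingType) (N : lmodType R) (S : set N)
    n (u : 'I_n -> N) : Prop :=
  forall w, exists c : 'I_n -> R, S (w - \sum_i c i *: u i).

Definition relations_mod (R : comNzRingType) (N : lmodType R) (S : set N)
    n (u : 'I_n -> N) : set 'M[R]_n :=
  [set A | forall i, S (\sum_j A i j *: u j)].

Definition fitting0 (R : comNzRingType) (N : lmodType R) (S : set N) : set R :=
  [set z | exists n (u : 'I_n -> N), generates_mod S u /\
     z \in gen_ideal R [set \det A | A in relations_mod S u]].

(* I(M) = Fitt_0(M^**/M) *)
Definition module_ideal (R : comNzRingType) (M : lmodType R) : set R :=
  fitting0 (range (@to_double_dual R M)).

Definition indecomposable (R : pzRingType) (U : lmodType R)
    (M : submodClosed U) : Prop :=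
  (exists2 v, v \in M & v != 0) /\
  forall A B : submodClosed U,
    {subset A <= M} -> {subset B <= M} ->
    (forall v, v \in M -> exists a b, [/\ a \in A, b \in B & v = a + b]) ->
    (forall v, v \in A -> v \in B -> v = 0) ->
    (forall v, v \in A -> v = 0) \/ (forall v, v \in B -> v = 0).

Definition discrete_valuation (K : fieldType) (v : K -> int) : Prop :=
  [/\ exists2 z, z != 0 & v z = 1,
      forall z w, z != 0 -> w != 0 -> v (z * w) = v z + v w
    & forall z w, z != 0 -> w != 0 -> z + w != 0 ->
        Num.min (v z) (v w) <= v (z + w)].

Definition valuation_subring (K : fieldType) (v : K -> int) : set K :=
  [set z | z != 0 -> 0 <= v z].

Definition is_dvr (K : fieldType) (V : set K) : Prop :=
  exists2 v, discrete_valuation v & V = valuation_subring v.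

(* For a submodule M of R^e, the modules M_K = M (x)_R K and MV, the image of
   M (x)_R V in M_K, are realised inside K^e as the K-span and the V-span of
   the image of M. *)
Section FractionField.
Context (R : idomainType) (e : nat).
Local Notation K := {fraction R}.
Local Notation tofrac := (@FracField.tofrac R).

Definition frac_image (M : {pred 'rV[R]_e}) : set 'rV[K]_e :=
  [set map_mx tofrac v | v in [set` M]].

Definition frac_module (M : {pred 'rV[R]_e}) : set 'rV[K]_e :=
  lincomb setT (frac_image M).

Definition has_rank (M : {pred 'rV[R]_e}) (d : nat) : Prop :=
  exists2 W : {vspace 'rV[K]_e}, [set` W] = frac_module M & \dim W = d.

Definition rees_closure (M : {pred 'rV[R]_e}) : set 'rV[K]_e :=
  [set f | frac_module M f /\
     forall V : set K, is_dvr V -> range tofrac `<=` V ->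
       lincomb V (frac_image M) f].

Definition integrally_closed (M : {pred 'rV[R]_e}) : Prop :=
  rees_closure M = frac_image M.

End FractionField.

Section MonomialModule.
Context (R : comNzRingType) (x y : R) (a b : nat -> nat) (r : nat).

Definition monomial_ideal : {pred R} :=
  gen_ideal R [set x ^+ a i * y ^+ b i | i in [set i | (i <= r)%N]].

Variable e : nat.

(* Standard basis of R^e, numbered from 1. *)
Definition eps (j : nat) : 'rV[R]_e := \row_(k < e) (k.+1 == j)%:R.

(* The natural-number subtractions are not truncated when a is decreasing, b is
   increasing with b 0 = 0, and a (r - e + 2) = e - 2. *)
Definition aprime (i : nat) : nat := (a i - (e - 1))%N.
Definition cexp (i : nat) : nat := (b (r - e + 1 + i) - i)%N.

Definition gen_f (i : nat) : 'rV[R]_e := (x ^+ aprime i * y ^+ b i) *: eps 1.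
Definition gen_g (i : nat) : 'rV[R]_e := y *: eps i + x *: eps i.+1.
Definition gen_h (i : nat) : 'rV[R]_e := y ^+ cexp i *: eps i.+1.

Definition monomial_module : submodClosed 'rV[R]_e :=
  span ([set gen_f i | i in [set i | (i <= r - e + 1)%N]] `|`
        [set gen_g i | i in [set i | (1 <= i <= e - 1)%N]] `|`
        [set gen_h i | i in [set i | (1 <= i <= e - 1)%N]]).

End MonomialModule.

(* Main.v *)
Require Import Defs.
From HB Require Import structures.
From mathcomp Require Import all_boot all_order all_algebra ring_quotient.
From mathcomp Require Import all_classical.
From mathcomp Require Import ring zify.
(* Imported again so that span denotes a generated submodule, not a vector space. *)
Require Import Defs.

(** Let pi : R^e -> R be the linear map with pi(eps_i) = x^(e-i) (-y)^(i-1).  By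
    Hilbert-Burch its kernel is generated by the vectors g_i, and it sends the f_i
    and, up to sign, the h_i to the monomials that generate I.  Hence M is the
    preimage pi^-1(I) ([mem_module]), and the theorem is read off from this.

    M is integrally closed.  Let f belong to M V for every discrete valuation ring V
    between R and K.  Its entries lie in every V, hence in R, because R is the
    intersection of these rings ([mem_range_of_dvr]); and pi(f) lies in every I V.  A
    complete monomial ideal contains every element of R that has this property
    ([not_mem_valuation]), so pi(f) is in I and f is in M.  For the last step: I is
    an intersection of ideals (x^i, y^j), one for each inner corner of its staircase;
    completeness says that the monomial just below such a corner is under the Newton
    polygon, so a weight with positive integer coefficients separates it from I, and
    the monomial valuation of that weight does the rest.

    I(M) = I.  Powers of x and of y multiply R^e into M and form a regular sequence,
    so linear forms on M extend to R^e, the double dual is R^e, and by Fitting's lemma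
    I(M) is generated by the determinants of the matrices with rows in M
    ([module_ideal_minors]).  The matrix with rows v, g_1, ..., g_(e-1) has determinant
    pi(v), which gives all of I.  Conversely let D have rows D_k in M.  Cramer's rule
    writes det(D) pi(eps_j) as a combination of the pi(D_k), which are in I, with the
    cofactors of D as coefficients.  All entries of D lie in the maximal ideal m, so at
    a given valuation the cofactors have value at least e-1 times that of x or of y,
    whichever is smaller.  For j = 1 or j = e respectively, the factor pi(eps_j) has
    exactly that value; so det(D) has at least the value of I at every valuation, and
    lies in I.

    M is indecomposable.  The projection onto a direct summand extends to an idempotent
    matrix phi over R.  In both cases of the theorem every f_i and h_i, except possibly
    f_0, which is a multiple of x eps_1, has order at least two ([generator_orders]), so
    modulo m^2 the module M lies in the span of x eps_1 and the g_i.  That this pencil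
    contains the images of the g_i under phi forces phi mod m to be a triangular
    Toeplitz matrix; its diagonal is constant, so an idempotent of this kind is 0 or 1
    ([idempotent_trivial]).

    Two facts about R carry this: x, y is a regular sequence ([param_regular]), and a
    nonzero prime ideal that misses x or y is principal ([prime_principal]).  Both come
    from descents that stop by the ascending chain condition, the first one together with
    the existence of a prime strictly between 0 and m. *)

Set Implicit Arguments.
Unset Strict Implicit.
Unset Printing Implicit Defensive.

Import Order.TTheory GRing.Theory Num.Theory.

Local Open Scope classical_set_scope.
Local Open Scope ring_scope.

(** * Generated submodules and ideals *)

Section SpanFacts.
Context (R : pzRingType) (U : lmodType R).
Implicit Types (G S : set U).

Lemma mem_span G v : G v -> v \in span G.
Proof.
move=> Gv; apply/asboolP; exists 1%N, (fun=> 1), (fun=> v); split=> //.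
by rewrite big_ord1 scale1r.
Qed.

Lemma span_min G S : S 0 -> (forall a u v, S u -> S v -> S (a *: u + v)) ->
  G `<=` S -> forall v, v \in span G -> S v.
Proof.
move=> S0 Sl GS v /asboolP [n [c [u [Gu ->]]]].
apply: (big_ind S) => // [p q Sp Sq|i _]; first by rewrite -[p]scale1r; exact: Sl.
by rewrite -[X in S X]addr0; apply: Sl => //; apply: GS; case: (Gu i).
Qed.

Lemma span_sub G (S : submodClosed U) :
  (forall v, G v -> v \in S) -> {subset span G <= S}.
Proof.
move=> GS; apply: (@span_min G (fun v => v \in S)) => //; first exact: rpred0.
by move=> a u v Su Sv; rewrite rpredD // rpredZ.
Qed.

Lemma submodB (S : submodClosed U) u v : u \in S -> v \in S -> u - v \in S.
Proof. by move=> uS vS; rewrite -scaleN1r rpredD ?rpredZ. Qed.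

End SpanFacts.

Section Ideals.
Context (R : comNzRingType).
Implicit Types (G S : set R) (c s t : R).

(** Divisibility by 0 means being 0, so the descent lemma below can also conclude that
    an element vanishes. *)
Definition divs c s : Prop := exists d, s = d * c.

Lemma divsMl c s t : divs c s -> divs c (t * s).
Proof. by case=> d ->; exists (t * d); rewrite mulrA. Qed.

Lemma divsD c s t : divs c s -> divs c t -> divs c (s + t).
Proof. by case=> d -> [d' ->]; exists (d + d'); rewrite mulrDl. Qed.

Lemma divsN c s : divs c s -> divs c (- s).
Proof. by move=> cs; rewrite -mulN1r; apply: divsMl. Qed.

Lemma divs_exp c i j : (i <= j)%N -> divs (c ^+ i) (c ^+ j).
Proof. by move=> ij; exists (c ^+ (j - i)); rewrite -exprD subnK. Qed.

Lemma mem_gen_ideal G s : G s -> s \in gen_ideal R G.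
Proof. exact: (@mem_span R R^o). Qed.

Lemma gen_ideal_min G S : S 0 -> (forall a s t, S s -> S t -> S (a * s + t)) ->
  G `<=` S -> forall s, s \in gen_ideal R G -> S s.
Proof. exact: (@span_min R R^o). Qed.

Lemma gen_ideal0 G : 0 \in gen_ideal R G.
Proof. exact: (rpred0 (@span R R^o G)). Qed.

Lemma gen_idealD G s t :
  s \in gen_ideal R G -> t \in gen_ideal R G -> s + t \in gen_ideal R G.
Proof. exact: (@rpredD R^o (@span R R^o G)). Qed.

Lemma gen_idealMl G c s : s \in gen_ideal R G -> c * s \in gen_ideal R G.
Proof. exact: (@rpredZ R R^o (@span R R^o G)). Qed.

Lemma gen_idealMr G c s : s \in gen_ideal R G -> s * c \in gen_ideal R G.
Proof. by rewrite mulrC; apply: gen_idealMl. Qed.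

Lemma gen_idealN G s : s \in gen_ideal R G -> - s \in gen_ideal R G.
Proof. by move=> Gs; rewrite -mulN1r gen_idealMl. Qed.

Lemma gen_ideal_sum G (I : Type) (r : seq I) (P : pred I) (F : I -> R) :
  (forall i, P i -> F i \in gen_ideal R G) ->
  \sum_(i <- r | P i) F i \in gen_ideal R G.
Proof.
move=> GF; apply: (big_ind (fun s => s \in gen_ideal R G)) => //.
- exact: gen_ideal0.
- by move=> s t; apply: gen_idealD.
Qed.

Lemma gen_ideal_sub G G' : (forall s, G s -> s \in gen_ideal R G') ->
  {subset gen_ideal R G <= gen_ideal R G'}.
Proof. exact: (@span_sub R R^o). Qed.

End Ideals.

(** * Noetherian descent *)

Section Noetherian.
Context (R : comUnitRingType) (noethR : noetherian R).
Implicit Types (c z s t : R).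

Lemma ascending_chain (J : nat -> set R) : (forall k, J k 0) ->
  (forall k a s t, J k s -> J k t -> J k (a * s + t)) ->
  (forall k, J k `<=` J k.+1) -> exists k, J k.+1 `<=` J k.
Proof.
move=> J0 Jl JS.
have Jle k l : (k <= l)%N -> J k `<=` J l.
  elim: l => [|l IHl]; first by rewrite leqn0 => /eqP ->.
  rewrite leq_eqVlt => /orP[/eqP -> //|kl] s /(IHl kl); exact: JS.
pose G : set R := [set s | exists k, J k s].
have [s sP] := noethR (@span R R^o G).
have GJ t : t \in gen_ideal R G -> exists k, J k t.
  apply: (@gen_ideal_min R G (fun t => exists k, J k t)) => //; first by exists 0%N.
  move=> a p q [k kp] [l lq]; exists (maxn k l).
  by apply: Jl; [apply: Jle kp|apply: Jle lq]; rewrite ?leq_maxl ?leq_maxr.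
have sJ (w : seq R) : {subset w <= gen_ideal R G} ->
    exists k, forall t, t \in w -> J k t.
  elim: w => [|t w IHw] wG; first by exists 0%N.
  have [u uw|k kP] := IHw; first by apply: wG; rewrite inE uw orbT.
  have [l lP] := GJ t (wG t (mem_head _ _)).
  exists (maxn k l) => u; rewrite inE => /orP[/eqP ->|/kP ku].
    by apply: Jle lP; rewrite leq_maxr.
  by apply: Jle ku; rewrite leq_maxl.
have [|k kP] := sJ s.
  by move=> t ts; rewrite sP; apply: mem_gen_ideal.
exists k => t Jt.
have: t \in gen_ideal R [set` s] by rewrite -sP; apply: mem_gen_ideal; exists k.+1.
apply: gen_ideal_min => //; exact: Jl.
Qed.

(** This plays the part of both Krull's intersection theorem and Nakayama's lemma.
    Iterating the hypothesis gives elements s_k with s_k in (c, z s_(k+1)), so the ideals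
    (c, s_k) ascend; where they become stationary, s_(k+1) lies in (c, z s_(k+1)), and
    1 - w z being a unit puts s_(k+1), hence every earlier s_k, in (c). *)
Lemma divs_of_descent c z (B : R -> Prop) :
  (forall w, 1 - w * z \is a GRing.unit) ->
  (forall s, B s -> exists2 s', B s' & divs c (s - s' * z)) ->
  forall s, B s -> divs c s.
Proof.
move=> zJ Bdesc s Bs.
have /choice [nx nxP] t : exists t', B t -> B t' /\ divs c (t - t' * z).
  by have [/Bdesc [t' Bt' ct']|nBt] := pselect (B t); [exists t'|exists 0].
pose q k := iter k nx s.
have Bq k : B (q k) by elim: k => //= k /nxP [].
have qS k : divs c (q k - q k.+1 * z) by have [] := nxP _ (Bq k).
pose J k : set R := [set t | exists d, divs c (t - d * q k)].
have Jl k a t t' : J k t -> J k t' -> J k (a * t + t').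
  move=> [d dP] [d' dP']; exists (a * d + d').
  have -> : a * t + t' - (a * d + d') * q k = a * (t - d * q k) + (t' - d' * q k) by ring.
  by apply: divsD => //; apply: divsMl.
have J0 k : J k 0 by exists 0; exists 0; ring.
have JS k : J k `<=` J k.+1.
  move=> t [d dP]; exists (d * z).
  have -> : t - d * z * q k.+1 = (t - d * q k) + d * (q k - q k.+1 * z) by ring.
  by apply: divsD => //; apply: divsMl.
have [k kP] := ascending_chain J0 Jl JS.
have [|d dP] := kP (q k.+1); first by exists 1; exists 0; ring.
have dq : divs c (q k.+1).
  have : divs c (q k.+1 * (1 - d * z)).
    have -> : q k.+1 * (1 - d * z) = (q k.+1 - d * q k) + d * (q k - q k.+1 * z) by ring.
    by apply: divsD => //; apply: divsMl.
  by move/(divsMl (1 - d * z)^-1); rewrite mulrC mulrK.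
elim: (k.+1) dq => // l IHl dl; apply: IHl.
have -> : q l = (q l - q l.+1 * z) + z * q l.+1 by ring.
by apply: divsD; [apply: qS|apply: divsMl].
Qed.

End Noetherian.

(** * Two-dimensional regular local rings *)

(** A prime ideal as a plain set, so that conductor ideals can be shown prime
    without building a structure on them. *)
Record prime_set (R : comNzRingType) (P : set R) : Prop := PrimeSet {
  prime_set0 : P 0;
  prime_setl : forall a s t, P s -> P t -> P (a * s + t);
  prime_set1 : ~ P 1;
  prime_setM : forall s t, P (s * t) -> P s \/ P t }.

(** What is used of a regular local ring of dimension two.  Krull dimension enters
    only through one prime ideal strictly between 0 and the maximal ideal.  The record is
    symmetric in x and y, so every consequence also holds with x and y exchanged. *)
Record parameters (R : idomainType) (x y : R) : Prop := RegularParams {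
  param_noetherian : noetherian R;
  param_unitPn : forall t, t \isn't a GRing.unit <-> exists c d, t = c * x + d * y;
  param_prime : exists P : set R, [/\ prime_set P,
    exists2 t, t != 0 & P t & exists2 t, t \isn't a GRing.unit & ~ P t] }.

Lemma parametersC (R : idomainType) (x y : R) : parameters x y -> parameters y x.
Proof.
case=> noethR loc primeR; split=> // t; rewrite loc.
by split=> -[c [d ->]]; exists d, c; rewrite addrC.
Qed.

Section Prime.
Context (R : comNzRingType) (P : set R) (primeP : prime_set P).

Lemma prime_setMl a s : P s -> P (a * s).
Proof. by move=> Ps; rewrite -[a * s]addr0; apply: prime_setl => //; apply: prime_set0. Qed.

Lemma prime_setX s n : P (s ^+ n) -> P s.
Proof.
elim: n => [|n IHn]; first by rewrite expr0 => /(prime_set1 primeP).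
by rewrite exprS => /(prime_setM primeP) [].
Qed.

End Prime.

Lemma regular_parameters (R : idomainType) (m : idealr R) (x y : R) :
  regular_local_ring2 m x y -> parameters x y.
Proof.
case=> noethR loc [[P PS] _] mxy; split=> // [t|].
  rewrite -loc mxy; split.
    apply: (@gen_ideal_min R _ (fun t => exists c d, t = c * x + d * y)).
    - by exists 0, 0; ring.
    - by move=> k s w [c [d ->]] [c' [d' ->]]; exists (k * c + c'), (k * d + d'); ring.
    - by move=> s [->|->]; [exists 1, 0|exists 0, 1]; ring.
  case=> c [d ->].
  by apply: gen_idealD; apply: gen_idealMl; apply: mem_gen_ideal; [left|right].
exists [set` P 1%N]; split.
- split=> /=; first exact: idealr0.
  + by move=> k s t Ps Pt; rewrite rpredD // idealMr.
  + by rewrite idealr1.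
  + by move=> s t; rewrite prime_idealrM => /orP.
- have [_ /existsNP [t /not_implyP [P1t P0t]]] := PS 0%N isT.
  by exists t => //; apply: contra_notN P0t => /eqP ->; apply: idealr0.
- have [_ /existsNP [t /not_implyP [P2t P1t]]] := PS 1%N isT.
  exists t => //; apply: contraTN P2t => tU /=.
  apply/negP => /(idealMr t^-1); rewrite mulVr //; apply/negP.
  by rewrite idealr1.
Qed.

Lemma nonunitMl (R : comUnitRingType) (c t : R) :
  t \isn't a GRing.unit -> c * t \isn't a GRing.unit.
Proof. by apply: contra; rewrite unitrM => /andP[]. Qed.

Section RegularParameters.
Context (R : idomainType) (x y : R) (xyP : parameters x y).
Implicit Types (c s t u z : R).

Let noethR := param_noetherian xyP.

Lemma param_nonunitD s t : s \isn't a GRing.unit -> t \isn't a GRing.unit ->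
  s + t \isn't a GRing.unit.
Proof.
move=> /(param_unitPn xyP) [c [d ->]] /(param_unitPn xyP) [c' [d' ->]].
by apply/(param_unitPn xyP); exists (c + c'), (d + d'); ring.
Qed.

Lemma param_nonunit_x : x \isn't a GRing.unit.
Proof. by apply/(param_unitPn xyP); exists 1, 0; ring. Qed.

Lemma param_unitD u t : u \is a GRing.unit -> t \isn't a GRing.unit ->
  u + t \is a GRing.unit.
Proof.
move=> uU tU; apply/negPn/negP => utU; move: uU; apply/negP.
by rewrite -(addrK t u); apply: param_nonunitD => //; rewrite -mulN1r nonunitMl.
Qed.

Lemma param_unit1B z c : z \isn't a GRing.unit -> 1 - c * z \is a GRing.unit.
Proof. by move=> zU; apply: param_unitD; rewrite ?unitr1 // -mulNr nonunitMl. Qed.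

(** Otherwise every quotient of t by a power of z is again divisible by z, and
    descent puts t in the zero ideal. *)
Lemma factor_power z t : z \isn't a GRing.unit -> t != 0 ->
  exists k s, t = s * z ^+ k /\ ~ divs z s.
Proof.
move=> zU /eqP t0; apply: contrapT => nfac; apply: t0.
pose B s := forall k q, s = q * z ^+ k -> divs z q.
have Bdiv : forall s, B s -> divs 0 s.
  apply: (divs_of_descent noethR (z := z)) => [w|s Bs]; first exact: param_unit1B.
  have [|s' sE] := Bs 0%N s; first by rewrite mulr1.
  exists s'; last by exists 0; rewrite sE; ring.
  by move=> k q s'E; apply: (Bs k.+1); rewrite sE s'E exprSr mulrA.
have [|d ->] := Bdiv t; last by rewrite mulr0.
by move=> k q tE; apply: contrapT => zq; apply: nfac; exists k, q.
Qed.

(** The maximal ideal of R/(x) is generated by y; an element that is no unit times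
    a power of y could be divided by y for ever. *)
Lemma unit_power_mod t : ~ divs x t ->
  exists k u, u \is a GRing.unit /\ divs x (t - u * y ^+ k).
Proof.
move=> xt; apply: contrapT => npow; apply: xt.
pose B s := ~ exists k u, u \is a GRing.unit /\ divs x (s - u * y ^+ k).
apply: (divs_of_descent noethR (z := y) (B := B)) => // [w|s Bs].
  by apply: param_unit1B; apply/(param_unitPn xyP); exists 0, 1; ring.
have /(param_unitPn xyP) [c [d sE]] : s \isn't a GRing.unit.
  apply/negP => sU; apply: Bs; exists 0%N, s; split=> //.
  by exists 0; ring.
exists d; last by exists c; rewrite sE; ring.
move=> [k [u [uU ud]]]; apply: Bs; exists k.+1, u; split=> //.
have -> : s - u * y ^+ k.+1 = c * x + y * (d - u * y ^+ k) by rewrite sE exprS; ring.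
by apply: divsD; [exists c|apply: divsMl].
Qed.

(** Modulo x each element of P is a unit times a power of y.  An element p of P whose
    power is least divides all the others modulo x, so P = (p) + x P, and descent along x
    gives P = (p). *)
Lemma prime_principal (P : set R) : prime_set P -> (exists2 t, t != 0 & P t) ->
  ~ P x -> exists p, [/\ p != 0, P p & forall q, P q -> divs p q].
Proof.
move=> primeP [t t0 Pt] xP.
pose lead j := exists s u, [/\ P s, u \is a GRing.unit & divs x (s - u * y ^+ j)].
have Plead s : P s -> ~ divs x s -> exists2 j, lead j &
    exists2 u, u \is a GRing.unit & divs x (s - u * y ^+ j).
  move=> Ps /unit_power_mod [j [u [uU us]]].
  by exists j; [exists s, u|exists u].
have [k [s [tE xs]]] := factor_power param_nonunit_x t0.
have Ps : P s.
  by move: Pt; rewrite tE => /(prime_setM primeP) [//|/(prime_setX primeP)].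
have [j0 j0l _] := Plead s Ps xs.
have exlead : exists j, `[< lead j >] by exists j0; apply/asboolP.
have [] := ex_minnP exlead => j /asboolP [p [u [Pp uU up]]] jmin.
have pdiv q : P q -> divs p q.
  apply: (divs_of_descent noethR (z := x) (B := P)) => [w|{}q Pq].
    exact/param_unit1B/param_nonunit_x.
  have [[d qE]|/(Plead q Pq) [i il [v vU vq]]] := pselect (divs x q).
    exists d; last by exists 0; rewrite qE; ring.
    by move: Pq; rewrite qE => /(prime_setM primeP) [].
  have ji : (j <= i)%N by apply: jmin; apply/asboolP.
  pose f := u^-1 * v * y ^+ (i - j).
  have [d dE] : divs x (q - f * p).
    have -> : q - f * p = (q - v * y ^+ i) - f * (p - u * y ^+ j).
      have fuy : f * (u * y ^+ j) = v * y ^+ i.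
        have -> : f * (u * y ^+ j) = (u^-1 * u) * v * (y ^+ (i - j) * y ^+ j).
          by rewrite /f; ring.
        by rewrite mulVr // mul1r -exprD subnK.
      by rewrite mulrBr fuy; ring.
    by apply: divsD => //; apply/divsN/divsMl.
  exists d; last by exists f; rewrite -dE; ring.
  have : P (d * x) by rewrite -dE -mulNr addrC; apply: prime_setl.
  by case/(prime_setM primeP).
exists p; split=> //; apply: contra_neq t0 => p0.
by have [d ->] := pdiv t Pt; rewrite p0 mulr0.
Qed.

(** This is where dimension two is used.  Suppose that x divides a power of y.  Then
    the intermediate prime P misses x, since otherwise it would contain y too; so it is
    generated by some p, and a power p^n is divisible by x.  Since x is not in P, the
    cofactor is again divisible by p^n, and x is a unit. *)
Lemma param_not_divs_power n : ~ divs x (y ^+ n).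
Proof.
have [P [primeP Pn0 [z zU zP]]] := param_prime xyP.
case=> c yn.
have xP : ~ P x.
  move=> Px; apply: zP; have /(param_unitPn xyP) [d [d' ->]] := zU.
  have Py : P y by apply: (@prime_setX _ _ primeP _ n); rewrite yn; apply: prime_setMl.
  by apply: prime_setl => //; apply: prime_setMl.
have [p [p0 Pp pP]] := prime_principal primeP Pn0 xP.
have pU : p \isn't a GRing.unit.
  apply/negP => pU; apply: (prime_set1 primeP).
  by rewrite -(mulVr pU); apply: prime_setMl.
have [d pn] : divs x (p ^+ n).
  have /(param_unitPn xyP) [d [d' ->]] := pU.
  have [q ->] : exists q, (d * x + d' * y) ^+ n = q * x + d' ^+ n * y ^+ n.
    elim: n {yn} => [|n [q IHn]]; first by exists 0; ring.
    by exists (q * (d * x + d' * y) + d' ^+ n * y ^+ n * d); rewrite exprS IHn !exprS; ring.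
  by apply: divsD; [exists q|rewrite yn; apply: divsMl; exists c].
have divp k : forall w, divs (p ^+ k) (w * x) -> divs (p ^+ k) w.
  elim: k => [|k IHk] w; first by exists w; rewrite mulr1.
  case=> v; rewrite exprS mulrA => wx.
  have [|w' wE] := IHk w; first by exists (v * p).
  have pk0 : p ^+ k != 0 by rewrite expf_neq0.
  have w'x : w' * x = v * p.
    by apply: (mulIf pk0); rewrite -wx wE; ring.
  have : P (w' * x) by rewrite w'x; apply: prime_setMl.
  case/(prime_setM primeP) => [/pP [w'' w'E]|//].
  by exists w''; rewrite wE w'E mulrA.
have [|d' dE] := divp n d; first by exists 1; rewrite mul1r.
have xd' : d' * x = 1.
  have pn0 : p ^+ n != 0 by rewrite expf_neq0.
  by apply: (mulIf pn0); rewrite mul1r {2}pn dE; ring.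
move: param_nonunit_x; apply/negP/negPn; apply/unitrP; exists d'.
by rewrite [x * _]mulrC xd'.
Qed.

Lemma param_neq0_y : y != 0.
Proof.
apply/eqP => y0; apply: (@param_not_divs_power 1).
by exists 0; rewrite y0 expr1 mul0r.
Qed.

Lemma param_regular1 t : divs x (y * t) -> divs x t.
Proof.
move=> xyt; apply: contrapT => /unit_power_mod [k [u [uU ut]]].
apply: (@param_not_divs_power k.+1).
have -> : y ^+ k.+1 = u^-1 * (y * t - y * (t - u * y ^+ k)).
  have -> : y * t - y * (t - u * y ^+ k) = u * y ^+ k.+1 by rewrite exprS; ring.
  by rewrite mulKr.
by apply/divsMl/divsD => //; apply/divsN/divsMl.
Qed.

End RegularParameters.

Section RegularSequence.
Context (R : idomainType) (x y : R) (xyP : parameters x y).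
Implicit Types (c s t u z : R).

Lemma param_neq0 : x != 0 /\ y != 0.
Proof. by split; [apply: (param_neq0_y (parametersC xyP))|apply: (param_neq0_y xyP)]. Qed.

Lemma param_regular i j t : divs (x ^+ i) (y ^+ j * t) -> divs (x ^+ i) t.
Proof.
have [x0 _] := param_neq0.
elim: j => [|j IHj]; first by rewrite mul1r.
rewrite exprS -mulrA => xyt; apply: IHj; move: (_ * t) xyt => {}t.
elim: i t => [|i IHi] t; first by exists t; rewrite mulr1.
case=> d yt.
have [|t' tE] := param_regular1 xyP (t := t).
  by exists (d * x ^+ i); rewrite yt exprSr mulrA.
have [|t'' t'E] := IHi t'.
  by exists d; apply: (mulIf x0); rewrite -mulrA -tE yt exprSr mulrA.
by exists t''; rewrite tE t'E exprSr mulrA.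
Qed.

(** Linear independence of monomials modulo the maximal ideal: x^i y^j is a socle
    generator modulo (x^(i+1), y^(j+1)). *)
Lemma param_monomial u i j c d : u \is a GRing.unit ->
  u * (x ^+ i * y ^+ j) = c * x ^+ i.+1 + d * y ^+ j.+1 -> False.
Proof.
have [x0 y0] := param_neq0 => uU E.
have [d' dE] : divs (x ^+ i) d.
  apply: (@param_regular _ j.+1); exists (u * y ^+ j - c * x).
  rewrite mulrC; have -> : d * y ^+ j.+1 = u * (x ^+ i * y ^+ j) - c * x ^+ i.+1 by rewrite E; ring.
  by rewrite exprSr; ring.
have E' : u * y ^+ j = c * x + d' * y ^+ j.+1.
  have xi0 : x ^+ i != 0 by rewrite expf_neq0.
  by apply: (mulIf xi0); rewrite mulrDl -[u * _ * _]mulrA [y ^+ j * _]mulrC E dE !exprSr; ring.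
have u'U : u - d' * y \is a GRing.unit.
  rewrite -mulNr; apply: (param_unitD xyP) => //; apply: nonunitMl.
  exact: (param_nonunit_x (parametersC xyP)).
apply: (@param_not_divs_power _ _ _ xyP j).
exists ((u - d' * y)^-1 * c); rewrite -mulrA.
have -> : c * x = (u - d' * y) * y ^+ j.
  by rewrite mulrBl E' exprSr; ring.
by rewrite mulKr.
Qed.

End RegularSequence.

(** * Discrete valuations on the fraction field *)

Section FractionValuation.
Context (R : idomainType).
Local Notation K := {fraction R}.
Local Notation tofrac := (@FracField.tofrac R).
Local Notation "s %:F" := (tofrac s).

Lemma fraction_quotient (z : K) : exists s t : R, t != 0 /\ z = s%:F / t%:F.
Proof.
exists (\n_(repr z)), (\d_(repr z)); split; first exact: denom_ratioP.
have d0 : (\d_(repr z))%:F != 0 by rewrite tofrac_eq0 denom_ratioP.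
apply: (mulIf d0); rewrite mulfVK // -{1}[z]reprK; unlock FracField.tofrac.
rewrite -[LHS]FracField.pi_mul; apply/eqmodP; rewrite /= FracField.equivfE /FracField.mulf.
rewrite !numden_Ratio ?mulf_neq0 ?denom_ratioP ?oner_neq0 //.
by rewrite !mulr1 mulrC.
Qed.

Definition nat_valuation (v : R -> nat) : Prop :=
  [/\ forall s t : R, s != 0 -> t != 0 -> v (s * t) = (v s + v t)%N,
      forall s t, s != 0 -> t != 0 -> s + t != 0 -> (minn (v s) (v t) <= v (s + t)%R)%N
    & exists s t, [/\ s != 0, t != 0 & v s = (v t).+1]].

(** The value of a fraction is the difference of the values of numerator and
    denominator. *)
Lemma nat_valuation_extends (v : R -> nat) : nat_valuation v ->
  exists2 w : K -> int, discrete_valuation w & forall s, s != 0 -> w s%:F = v s.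
Proof.
case=> vM vD [s1 [t1 [s10 t10 v1]]].
have [num /choice [den frE]] := choice fraction_quotient.
have den0 z : den z != 0 by have [] := frE z.
have num0 z : z != 0 -> num z != 0.
  by have [_ {1}->] := frE z; apply: contra_neq => ->; rewrite rmorph0 mul0r.
have nE z : z != 0 -> z * (den z)%:F = (num z)%:F.
  by have [_ {2}->] := frE z => _; rewrite mulfVK // tofrac_eq0.
pose w z : int := (v (num z))%:Z - (v (den z))%:Z.
have wE (z : K) s t : s != 0 -> t != 0 -> z * t%:F = s%:F -> w z = (v s)%:Z - (v t)%:Z.
  move=> s0 t0 zt.
  have z0 : z != 0.
    by apply: contra_neq s0 => z0; apply/eqP; rewrite -tofrac_eq0 -zt z0 mul0r.
  have E : s * den z = num z * t.
    by apply/eqP; rewrite -tofrac_eq !rmorphM /= -zt -nE //; apply/eqP; ring.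
  have := congr1 v E; rewrite !vM ?num0 ?den0 // /w; lia.
exists w; last first.
  move=> s s0; rewrite (wE _ s 1) ?oner_neq0 ?rmorph1 ?mulr1 //.
  have := vM 1 1 (oner_neq0 _) (oner_neq0 _); rewrite mulr1; lia.
split.
- exists (s1%:F / t1%:F); first by rewrite mulf_neq0 ?invr_eq0 ?tofrac_eq0.
  rewrite (wE _ s1 t1) // ?v1; first by lia.
  by rewrite mulfVK // tofrac_eq0.
- move=> z z' z0 z'0.
  rewrite (wE (z * z') (num z * num z') (den z * den z')) ?mulf_neq0 ?num0 ?den0 //.
    by rewrite !vM ?num0 ?den0 // /w; lia.
  by rewrite !rmorphM /= -!nE //; ring.
- move=> z z' z0 z'0 zz'0.
  pose s := num z * den z'; pose s' := num z' * den z; pose t := den z * den z'.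
  have t0 : t != 0 by rewrite mulf_neq0.
  have E : (z + z') * t%:F = (s + s')%:F.
    by rewrite rmorphD !rmorphM /= -!nE //; ring.
  have ss'0 : s + s' != 0 by rewrite -tofrac_eq0 -E mulf_neq0 ?tofrac_eq0.
  have s0 : s != 0 by rewrite mulf_neq0 ?num0.
  have s'0 : s' != 0 by rewrite mulf_neq0 ?num0.
  rewrite (wE (z + z') (s + s') t) //.
  have := vD s s' s0 s'0 ss'0; rewrite /s /s' /t !vM ?num0 ?den0 // geq_min ge_min /w.
  move: (v (_ + _)) (v (num z)) (v (num z')) (v (den z)) (v (den z')) => k k1 k2 k3 k4.
  by move=> /orP h; apply/orP; case: h => h; [left|right]; lia.
Qed.

End FractionValuation.

Section ValuationBounds.
Context (K : fieldType) (w : K -> int) (dw : discrete_valuation w).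
Implicit Types (z : K) (n : int).

(** For n = 0 this is the valuation ring of w, and in general a fractional ideal of it;
    zero is included because the value of zero is arbitrary. *)
Definition val_ge n : set K := [set z | z != 0 -> n <= w z].

Lemma val_ge0 n : val_ge n 0.
Proof. by rewrite /val_ge /= eqxx. Qed.

Lemma val_geM n n' z z' : val_ge n z -> val_ge n' z' -> val_ge (n + n') (z * z').
Proof.
have [_ wM _] := dw => zn z'n; rewrite /val_ge /= mulf_eq0 negb_or.
by case/andP=> z0 z'0; rewrite wM // lerD ?zn ?z'n.
Qed.

Lemma val_geMl n z z' : valuation_subring w z -> val_ge n z' -> val_ge n (z * z').
Proof. by move=> Vz zn; rewrite -[n]add0r; apply: val_geM. Qed.

Lemma val_geD n z z' : val_ge n z -> val_ge n z' -> val_ge n (z + z').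
Proof.
have [_ _ wD] := dw => zn z'n zz'0.
have [z0|z0] := eqVneq z 0; first by move: zz'0; rewrite z0 add0r => /z'n.
have [z'0|z'0] := eqVneq z' 0; first by move: zz'0; rewrite z'0 addr0 => /zn.
apply: le_trans (wD _ _ z0 z'0 zz'0).
by rewrite le_min zn ?z'n.
Qed.

Lemma val_ge_sum n (I : Type) (r : seq I) (P : pred I) (F : I -> K) :
  (forall i, P i -> val_ge n (F i)) -> val_ge n (\sum_(i <- r | P i) F i).
Proof.
by move=> VF; apply: big_ind => //; [apply: val_ge0|move=> z z'; apply: val_geD].
Qed.

Lemma discrete_valuation1 : w 1 = 0.
Proof.
have [_ wM _] := dw; have := wM 1 1 (oner_neq0 _) (oner_neq0 _).
by rewrite mulr1; lia.
Qed.

Lemma discrete_valuationX z k : z != 0 -> w (z ^+ k) = w z *+ k.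
Proof.
have [_ wM _] := dw => z0; elim: k => [|k IHk]; first by rewrite discrete_valuation1.
by rewrite exprS wM ?expf_neq0 // IHk mulrS.
Qed.

Lemma val_ge_prod n k (F : 'I_k -> K) :
  (forall i, val_ge n (F i)) -> val_ge (n *+ k) (\prod_i F i).
Proof.
elim: k F => [|k IHk] F nF; first by rewrite big_ord0 /val_ge /= discrete_valuation1.
by rewrite big_ord_recl mulrS; apply: val_geM => //; apply: IHk.
Qed.

End ValuationBounds.

(** * R is the intersection of the discrete valuation rings above it *)

Section Normal.
Context (R : idomainType) (x y : R) (xyP : parameters x y).
Local Notation K := {fraction R}.
Local Notation tofrac := (@FracField.tofrac R).
Local Notation "s %:F" := (tofrac s).

Lemma prime_adic_valuation (P : set R) p : prime_set P -> p != 0 -> P p ->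
  (forall q, P q -> divs p q) ->
  exists2 v : R -> nat, nat_valuation v & v p = 1%N /\ (forall s, ~ P s -> v s = 0%N).
Proof.
move=> primeP p0 Pp pP.
have pU : p \isn't a GRing.unit.
  apply/negP => pU; apply: (prime_set1 primeP).
  by rewrite -(mulVr pU); apply: prime_setMl.
have Pdivs s : divs p s -> P s by case=> d ->; apply: prime_setMl.
have fac t : exists ks : nat * R, t != 0 -> t = ks.2 * p ^+ ks.1 /\ ~ P ks.2.
  have [->|t0] := eqVneq t 0; first by exists (0%N, 0).
  have [k [s [tE ps]]] := factor_power xyP pU t0.
  by exists (k, s) => _; split=> // /pP.
have [f fP] := choice fac.
pose v t := (f t).1.
have vE k s : ~ P s -> v (s * p ^+ k) = k.
  move=> Ps; have s0 : s != 0 by apply: contra_not_neq Ps => ->; apply: prime_set0.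
  have t0 : s * p ^+ k != 0 by rewrite mulf_neq0 ?expf_neq0.
  have [] := fP _ t0; rewrite -/(v _).
  move: (f _).2 (v _) => s' n E Ps'.
  have pn0 i : p ^+ i != 0 by rewrite expf_neq0.
  have Pmul r i : (0 < i)%N -> P (r * p ^+ i).
    move=> i0; apply: (prime_setMl primeP).
    by rewrite -(prednK i0) exprS mulrC; apply: prime_setMl.
  have [lt|lt|//] := ltngtP n k.
    case: Ps'; have -> : s' = s * p ^+ (k - n).
      by apply: (mulIf (pn0 n)); rewrite -E -mulrA -exprD subnK // ltnW.
    by apply: Pmul; rewrite subn_gt0.
  case: Ps; have -> : s = s' * p ^+ (n - k).
    by apply: (mulIf (pn0 k)); rewrite E -mulrA -exprD subnK // ltnW.
  by apply: Pmul; rewrite subn_gt0.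
have vP t : t != 0 -> exists2 s, ~ P s & t = s * p ^+ v t.
  by move=> /fP [tE Ps]; exists (f t).2.
have vp : v p = 1%N.
  by rewrite -[p]mul1r -[X in v (1 * X)]expr1 vE //; apply: prime_set1.
have v0 s : ~ P s -> v s = 0%N.
  by move=> Ps; rewrite -[s]mulr1 -[X in v (s * X)](expr0 p) vE.
exists v => //; split.
- move=> s t /vP [s' Ps' sE] /vP [t' Pt' tE].
  have -> : s * t = s' * t' * p ^+ (v s + v t) by rewrite {1}sE {1}tE exprD; ring.
  by rewrite vE // => /(prime_setM primeP) [].
- move=> s t s0 t0 st0.
  have [s' Ps' sE] := vP s s0; have [t' Pt' tE] := vP t t0; have [q Pq qE] := vP _ st0.
  set n := minn _ _; rewrite leqNgt; apply/negP => lt; apply: Pq; apply: Pdivs.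
  set k := v (s + t) in lt qE.
  have pk0 : p ^+ k != 0 by rewrite expf_neq0.
  exists ((s' * p ^+ (v s - n) + t' * p ^+ (v t - n)) * p ^+ (n - k.+1)).
  apply: (mulIf pk0); rewrite -qE -!mulrA -exprS -exprD subnK //.
  by rewrite mulrDl -!mulrA -!exprD !subnK ?geq_minr ?geq_minl // -sE -tE.
- by exists p, 1; rewrite p0 oner_neq0 vp v0 //; apply: prime_set1.
Qed.

(** If z is not in R, some multiple s z outside R has a maximal conductor
    C = (R : s z), which is prime.  If C misses x or y it is generated by some p, and z has
    negative p-adic value.  If C contains both, then x s z and y s z are in R, and s z is in
    R because x, y is a regular sequence. *)
Lemma mem_range_of_dvr (z : K) :
  (forall V, is_dvr V -> range tofrac `<=` V -> V z) -> range tofrac z.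
Proof.
move=> zV; apply: contrapT => zR.
pose good s := ~ range tofrac (s%:F * z).
pose C s : set R := [set t | range tofrac (t%:F * (s%:F * z))].
(* Without a maximal conductor there would be a strictly ascending chain. *)
have [s gs smax] : exists2 s, good s & forall t, good (t * s) -> C (t * s) `<=` C s.
  apply: contrapT => nmax.
  have nx s : exists t, good s -> good (t * s) /\ ~ (C (t * s) `<=` C s).
    have [gs|ngs] := pselect (good s); last by exists 0.
    apply: contrapT => nt; apply: nmax; exists s => // t gt.
    by apply: contrapT => nC; apply: nt; exists t.
  have [f fP] := choice nx.
  pose q k := iter k (fun s => f s * s) 1.
  have gq k : good (q k).
    elim: k => [|k /fP [] //]; by rewrite /good /q /= rmorph1 mul1r.
  have [k kP] : exists k, C (q k.+1) `<=` C (q k).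
    apply: (ascending_chain (param_noetherian xyP) (J := fun k => C (q k))) => k.
    - by exists 0 => //; rewrite rmorph0 mul0r.
    - move=> c s t [a _ aE] [b _ bE]; exists (c * a + b) => //.
      by rewrite rmorphD rmorphM /= aE bE rmorphD rmorphM /=; ring.
    - move=> t [a _ aE]; exists (f (q k) * a) => //.
      by rewrite rmorphM /= aE /q /= rmorphM /=; ring.
  by have [_] := fP _ (gq k); apply.
have primeC : prime_set (C s).
  split.
  - by exists 0 => //; rewrite rmorph0 mul0r.
  - move=> c t t' [a _ aE] [b _ bE]; exists (c * a + b) => //.
    by rewrite !rmorphD !rmorphM /= aE bE; ring.
  - by rewrite /C /= rmorph1 mul1r.
  - move=> t t' Ctt'; have [gt'|] := pselect (good (t' * s)); last first.
      move=> /contrapT; rewrite rmorphM /= -mulrA => Ct'; by right.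
    left; apply: (smax t') => //; case: Ctt' => a _ aE; exists a => //.
    by rewrite aE !rmorphM /=; ring.
have Cn0 : exists2 t, t != 0 & C s t.
  have [n [d [d0 zE]]] := fraction_quotient z; exists d => //.
  exists (s * n) => //; rewrite rmorphM /= zE.
  have dF0 : d%:F != 0 by rewrite tofrac_eq0.
  by rewrite mulrCA [d%:F * _]mulrC mulfVK.
(* C contains p but not p s z, so s z has value -1 while s has value at least 0. *)
have valC p : p != 0 -> C s p -> (forall q, C s q -> divs p q) -> False.
  move=> p0 Cp pC.
  have [v vv [vp v0]] := prime_adic_valuation primeC p0 Cp pC.
  have [w dw wv] := nat_valuation_extends vv.
  have wR : range tofrac `<=` valuation_subring w.
    by move=> _ [t _ <-]; rewrite /valuation_subring /= tofrac_eq0 => t0; rewrite wv.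
  have Vz : valuation_subring w z by apply: zV => //; exists w.
  have Vsz : valuation_subring w (s%:F * z).
    by apply: (val_geMl dw) => //; apply: wR; exists s.
  have [c _ cE] := Cp.
  have sz0 : s%:F * z != 0.
    by apply: contra_notN gs => /eqP ->; exists 0 => //; rewrite rmorph0.
  have nCc : ~ C s c.
    move=> /pC [d dE]; apply: gs; exists d => //.
    by apply: (mulfI (x := p%:F)); rewrite ?tofrac_eq0 // -cE dE rmorphM /= mulrC.
  have c0 : c != 0 by rewrite -tofrac_eq0 cE mulf_neq0 ?tofrac_eq0.
  have [_ wM _] := dw.
  have := congr1 w cE; rewrite wM ?tofrac_eq0 // !wv // vp v0 //.
  by have := Vsz sz0; lia.
have [Cx|nCx] := pselect (C s x); last first.
  by have [p [p0 Cp pC]] := prime_principal xyP primeC Cn0 nCx; apply: (valC p).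
have [Cy|nCy] := pselect (C s y); last first.
  have [p [p0 Cp pC]] := prime_principal (parametersC xyP) primeC Cn0 nCy.
  by apply: (valC p).
have [c _ cE] := Cx; have [d _ dE] := Cy.
have [x0 y0] := param_neq0 xyP.
have E : y * c = x * d.
  by apply/eqP; rewrite -tofrac_eq !rmorphM /= cE dE; apply/eqP; ring.
have [t tE] : divs x c by apply: (param_regular1 xyP); exists d; rewrite E mulrC.
apply: gs; exists t => //.
by apply: (mulfI (x := x%:F)); rewrite ?tofrac_eq0 // -cE tE rmorphM /= mulrC.
Qed.

End Normal.

(** * Monomial ideals and monomial valuations *)

Section MonomialIdeals.
Context (R : idomainType) (x y : R) (xyP : parameters x y).
Implicit Types (S T : set (nat * nat)) (mu nu : nat * nat) (c s t u : R).

Definition monomial mu : R := x ^+ mu.1 * y ^+ mu.2.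

Definition monomials_ideal S : {pred R} := gen_ideal R (monomial @` S).

Definition exp_add mu nu : nat * nat := ((mu.1 + nu.1)%N, (mu.2 + nu.2)%N).

Lemma monomialM mu nu : monomial mu * monomial nu = monomial (exp_add mu nu).
Proof. by rewrite /monomial !exprD; ring. Qed.

Lemma monomial_mem S mu : S mu -> monomial mu \in monomials_ideal S.
Proof. by move=> Smu; apply: mem_gen_ideal; exists mu. Qed.

Lemma monomials_idealS S T : S `<=` T -> {subset monomials_ideal S <= monomials_ideal T}.
Proof. by move=> ST; apply: gen_ideal_sub => _ [mu /ST Tmu <-]; apply: monomial_mem. Qed.

Lemma monomials_ideal_min S (T : set R) : T 0 ->
  (forall a s t, T s -> T t -> T (a * s + t)) ->
  (forall mu, S mu -> T (monomial mu)) -> forall t, t \in monomials_ideal S -> T t.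
Proof. by move=> T0 Tl ST; apply: gen_ideal_min => // _ [mu Smu <-]; apply: ST. Qed.

Lemma monomials_idealM S S' T s t :
  (forall mu nu, S mu -> S' nu -> T (exp_add mu nu)) ->
  s \in monomials_ideal S -> t \in monomials_ideal S' -> s * t \in monomials_ideal T.
Proof.
move=> SS'T Ss; move: t.
apply: (@monomials_ideal_min S' [set t | s * t \in monomials_ideal T]) => /=.
- by rewrite mulr0 gen_ideal0.
- by move=> a t t' st st'; rewrite mulrDr mulrCA; apply: gen_idealD => //; apply: gen_idealMl.
- move=> nu S'nu; move: s Ss.
  apply: (@monomials_ideal_min S [set s | s * monomial nu \in monomials_ideal T]) => /=.
  + by rewrite mul0r gen_ideal0.
  + by move=> a s s' st st'; rewrite mulrDl -mulrA; apply: gen_idealD => //; apply: gen_idealMl.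
  + by move=> mu Smu; rewrite monomialM; apply/monomial_mem/SS'T.
Qed.

Lemma monomials_ideal_powers S mu t :
  (forall nu, S nu -> (mu.1 < nu.1)%N \/ (mu.2 < nu.2)%N) ->
  t \in monomials_ideal S -> exists c d, t = c * x ^+ mu.1.+1 + d * y ^+ mu.2.+1.
Proof.
move=> Smu; move: t; apply: monomials_ideal_min.
- by exists 0, 0; ring.
- move=> a s t [c [d ->]] [c' [d' ->]].
  by exists (a * c + c'), (a * d + d'); ring.
- move=> nu /Smu [lt|lt].
    exists (x ^+ (nu.1 - mu.1.+1) * y ^+ nu.2), 0.
    by rewrite mul0r addr0 mulrAC -exprD subnK.
  exists 0, (x ^+ nu.1 * y ^+ (nu.2 - mu.2.+1)).
  by rewrite mul0r add0r -mulrA -exprD subnK.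
Qed.

(** If no element of S divides x^i y^j, then all of S lies in (x^(i+1), y^(j+1)), and
    no unit multiple of x^i y^j does. *)
Lemma unit_monomial_mem S mu u : u \is a GRing.unit ->
  u * monomial mu \in monomials_ideal S ->
  exists nu, [/\ S nu, (nu.1 <= mu.1)%N & (nu.2 <= mu.2)%N].
Proof.
move=> uU uS; apply: contrapT => nS.
have [|c [d E]] := monomials_ideal_powers (mu := mu) _ uS.
  move=> nu Snu; have [le1|] := leqP nu.1 mu.1; last by left.
  have [le2|] := leqP nu.2 mu.2; last by right.
  by case: nS; exists nu.
exact: (param_monomial xyP uU E).
Qed.

(** Write t = s x^i with s not divisible by x, and s = u y^j modulo x with u a unit:
    the exponent (i, j) has the required property.  In particular no nonzero element lies in
    monomial ideals of arbitrarily high order. *)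
Lemma separating_monomial t : t != 0 -> exists mu, forall S,
  (forall nu, S nu -> (mu.1 < nu.1)%N \/ (mu.2 < nu.2)%N) -> t \notin monomials_ideal S.
Proof.
move=> t0.
have [i [s [tE xs]]] := factor_power xyP (param_nonunit_x xyP) t0.
have [j [u [uU [z zE]]]] := unit_power_mod xyP xs.
exists (i, j) => S Sij; apply/negP => /(monomials_ideal_powers (mu := (i, j))) [] // c [d E].
apply: (param_monomial xyP (u := u) (i := i) (j := j) (c := c - z) (d := d) uU).
have {}tE : t = (u * y ^+ j + z * x) * x ^+ i by rewrite -zE addrC subrK.
by rewrite mulrBl addrAC -E tE exprS; ring.
Qed.

Section Weight.
Context (p q : nat) (p_gt0 : (0 < p)%N) (q_gt0 : (0 < q)%N).

Definition weight mu : nat := (p * mu.1 + q * mu.2)%N.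

Definition weight_ideal n : {pred R} := monomials_ideal [set mu | (n <= weight mu)%N].

(** Monomials ordered by weight, ties being broken by the exponent of x: the order
    is compatible with products, and two monomials never tie. *)
Definition later mu : set (nat * nat) :=
  [set nu | (weight mu < weight nu)%N \/ weight nu = weight mu /\ (mu.1 < nu.1)%N].

Definition leading t mu : Prop :=
  exists2 u, u \is a GRing.unit & t - u * monomial mu \in monomials_ideal (later mu).

Lemma weightD mu nu : weight (exp_add mu nu) = (weight mu + weight nu)%N.
Proof. rewrite /weight /=; lia. Qed.

Lemma weight_divides mu nu : (nu.1 <= mu.1)%N -> (nu.2 <= mu.2)%N ->
  (weight nu <= weight mu)%N /\ (weight nu = weight mu -> nu = mu).
Proof.
case: mu nu => [i j] [i' j'] /= le1 le2.
have := leq_mul (leqnn p) le1; have := leq_mul (leqnn q) le2.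
rewrite /weight /= => h1 h2; split=> [|h]; first lia.
have /eqP : (p * i' = p * i)%N by lia.
have /eqP : (q * j' = q * j)%N by lia.
by rewrite !eqn_pmul2l // => /eqP -> /eqP ->.
Qed.

Lemma leading_weight_le t mu n : leading t mu -> t \in weight_ideal n -> (n <= weight mu)%N.
Proof.
case=> u uU tu tn; rewrite leqNgt; apply/negP => lt.
have : u * monomial mu \in
    monomials_ideal [set nu | later mu nu \/ (n <= weight nu)%N].
  have -> : u * monomial mu = t - (t - u * monomial mu) by ring.
  apply: gen_idealD; first by apply: monomials_idealS tn => nu; right.
  by apply: gen_idealN; apply: monomials_idealS tu => nu; left.
move=> /(unit_monomial_mem uU) [nu [Snu le1 le2]].
have [wle weq] := weight_divides le1 le2.
case: Snu => [[?|[/weq -> ]]|?]; lia.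
Qed.

Lemma leading_mem t mu : leading t mu -> t \in weight_ideal (weight mu).
Proof.
case=> u uU tu; rewrite -(subrK (u * monomial mu) t); apply: gen_idealD.
  apply: monomials_idealS tu => nu /= [|[-> _]] //; exact: ltnW.
by apply: gen_idealMl; apply: monomial_mem => /=.
Qed.

(** Leading units are multiplied, and a product of two units is a unit; this is why
    the weight of the leading monomial is a valuation. *)
Lemma leadingM s t mu nu : leading s mu -> leading t nu -> leading (s * t) (exp_add mu nu).
Proof.
move=> [u uU su] [v vU tv]; exists (u * v); first by rewrite unitrM uU.
have -> : s * t - u * v * monomial (exp_add mu nu) =
  u * (monomial mu * (t - v * monomial nu)) + v * (monomial nu * (s - u * monomial mu))
  + (s - u * monomial mu) * (t - v * monomial nu).
  by rewrite -monomialM; ring.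
have mem rho : monomial rho \in monomials_ideal [set rho] by apply: monomial_mem.
apply: gen_idealD; first (apply: gen_idealD; apply: gen_idealMl).
- apply: (monomials_idealM _ (mem mu) tv) => _ rho -> /=; rewrite /later /= !weightD /=; lia.
- apply: (monomials_idealM _ (mem nu) su) => _ rho -> /=; rewrite /later /= !weightD /=; lia.
- apply: (monomials_idealM _ su tv) => rho rho'; rewrite /later /= !weightD /=; lia.
Qed.

(** If t had no leading monomial, its coefficient at each monomial in turn would be in
    the maximal ideal and could be pushed to later monomials, so t would lie in the ideal
    of all monomials of weight at least n for every n. *)
Lemma leading_exists t : t != 0 -> exists mu, leading t mu.
Proof.
move=> t0; apply: contrapT => nlead.
(* What remains after the monomials before weight n and exponent k of x. *)
pose L n k : set (nat * nat) :=
  [set mu | (n < weight mu)%N \/ weight mu = n /\ (k <= mu.1)%N].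
have LS n k : t \in monomials_ideal (L n k) -> t \in monomials_ideal (L n k.+1).
  have [[j wj]|nj] := pselect (exists j, weight (k, j) = n); last first.
    apply: monomials_idealS => -[i j]; rewrite /L /= => -[lt|[wij ki]]; first by left.
    right; split=> //; rewrite ltn_neqAle ki andbT; apply/eqP => kE.
    by apply: nj; exists j; rewrite kE.
  move=> tL.
  have [c [s [sL tE]]] : exists c s, s \in monomials_ideal (L n k.+1) /\
      t = c * monomial (k, j) + s.
    move: tL; move: t {t0 nlead}; apply: monomials_ideal_min.
    - by exists 0, 0; rewrite gen_ideal0; split=> //; ring.
    - move=> a s t [c [s' [s'L ->]]] [d [t' [t'L ->]]].
      exists (a * c + d), (a * s' + t'); split; last by ring.
      by apply: gen_idealD => //; apply: gen_idealMl.
    - move=> mu Lmu; have [muE|mu_neq] := eqVneq mu (k, j).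
        by exists 1, 0; rewrite gen_ideal0 muE; split=> //; ring.
      exists 0, (monomial mu); split; last by ring.
      apply: monomial_mem; case: Lmu => [lt|[wmu le]]; first by left.
      right; split=> //; rewrite ltn_neqAle le andbT.
      apply: contra_neq mu_neq => kE; case: mu wmu kE {le} => [i l] /= wil kE.
      rewrite -kE; congr (_, _); move: wj wil; rewrite /weight /= -kE => <- h.
      have /eqP : (q * l = q * j)%N by lia.
      by rewrite eqn_pmul2l // => /eqP.
  have [cU|/(param_unitPn xyP) [d [d' cE]]] := boolP (c \is a GRing.unit).
    case: nlead; exists (k, j); exists c => //.
    have -> : t - c * monomial (k, j) = s by rewrite tE; ring.
    by apply: monomials_idealS sL => mu; rewrite /L /later /= wj.
  rewrite tE cE; apply: gen_idealD => //.
  have -> : (d * x + d' * y) * monomial (k, j) =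
      d * monomial (k.+1, j) + d' * monomial (k, j.+1).
    by rewrite /monomial /= !exprS; ring.
  by apply: gen_idealD; apply: gen_idealMl; apply: monomial_mem; left;
    rewrite -wj /weight /=; nia.
have Lk n k : t \in monomials_ideal (L n 0%N) -> t \in monomials_ideal (L n k).
  by move=> tL; elim: k => // k; apply: LS.
have Ln n : t \in monomials_ideal (L n 0%N).
  elim: n => [|n IHn].
    rewrite -[t]mulr1; apply: gen_idealMl.
    have -> : 1 = monomial (0, 0)%N :> R by rewrite /monomial /= !expr0 mulr1.
    by apply: monomial_mem; right; rewrite /weight /= !muln0.
  apply: monomials_idealS (Lk n n.+1 IHn) => mu; rewrite /L /weight /=.
  by move=> [lt|[wE le]]; nia.
have [mu muP] := separating_monomial t0.
move: (Ln (weight mu).+1); apply/negP/muP => nu Lnu.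
have lt : (weight mu < weight nu)%N by case: Lnu => [|[->]] //; lia.
have [le1|?] := leqP nu.1 mu.1; last by left.
have [le2|?] := leqP nu.2 mu.2; last by right.
have [] := weight_divides le1 le2; lia.
Qed.

(** As p and q are coprime, a power of x and a power of y have values that differ by 1. *)
Lemma weight_valuation : coprime p q -> exists2 v : R -> nat, nat_valuation v &
  forall t n, t != 0 -> (n <= v t)%N = (t \in weight_ideal n).
Proof.
move=> pq.
have /choice [mu muP] t : exists mu, t != 0 -> leading t mu.
  by have [->|/leading_exists [mu]] := eqVneq t 0; [exists (0, 0)%N|exists mu].
pose v t := weight (mu t).
have vE t n : t != 0 -> (n <= v t)%N = (t \in weight_ideal n).
  move=> t0; apply/idP/idP; last exact: leading_weight_le (muP t t0).
  move=> le; apply: monomials_idealS (leading_mem (muP t t0)) => nu /=; exact: leq_trans.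
have vlead t nu : t != 0 -> leading t nu -> v t = weight nu.
  move=> t0 lt; apply/eqP; rewrite eqn_leq vE // leading_mem // andbT.
  exact: leading_weight_le lt (leading_mem (muP t t0)).
exists v => //; split.
- move=> s t s0 t0; rewrite (@vlead _ (exp_add (mu s) (mu t))) ?mulf_neq0 ?weightD //.
  by apply: leadingM; apply: muP.
- move=> s t s0 t0 st0; rewrite vE //; apply: gen_idealD.
    by rewrite -[_ \in _]vE // geq_minl.
  by rewrite -[_ \in _]vE // geq_minr.
- have [x0 y0] := param_neq0 xyP.
  have v_mon nu : v (monomial nu) = weight nu.
    apply: vlead; first by rewrite mulf_neq0 ?expf_neq0.
    by exists 1; rewrite ?unitr1 // mul1r subrr gen_ideal0.
  have [i j ij _] := egcdnP q p_gt0.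
  exists (monomial (i, 0)%N), (monomial (0, j)%N).
  split; try by rewrite mulf_neq0 ?expf_neq0.
  move: ij; rewrite !v_mon /weight /= (eqP pq); lia.
Qed.

End Weight.

End MonomialIdeals.

(** * Separating an element from a complete monomial ideal *)

(** Maximises f/g by cross-multiplication. *)
Lemma max_ratio (f g : nat -> nat) n : (forall i, (i <= n)%N -> (0 < g i)%N) ->
  exists2 k, (k <= n)%N & forall i, (i <= n)%N -> (f i * g k <= f k * g i)%N.
Proof.
elim: n => [|n IHn] g0; first by exists 0%N => // i; rewrite leqn0 => /eqP ->.
have [i le|k kn kmax] := IHn; first by apply: g0; apply: leqW.
have [le|/ltnW le] := leqP (f n.+1 * g k) (f k * g n.+1).
  exists k => [|i]; first exact: leqW.
  by rewrite leq_eqVlt => /orP[/eqP -> //|]; apply: kmax.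
exists n.+1 => // i; rewrite leq_eqVlt => /orP[/eqP -> //|lt].
rewrite -(leq_pmul2r (g0 k (leqW kn))).
have h1 : (f i * g k * g n.+1 <= f k * g i * g n.+1)%N by rewrite leq_mul2r kmax ?orbT.
have h2 : (f k * g n.+1 * g i <= f n.+1 * g k * g i)%N by rewrite leq_mul2r le ?orbT.
nia.
Qed.

Lemma decreasing_gap r (f : nat -> nat) : (forall i, (i < r)%N -> (f i.+1 < f i)%N) ->
  forall i j, (i <= j)%N -> (j <= r)%N -> (f j + (j - i) <= f i)%N.
Proof.
move=> f_decr i; elim=> [|j IHj]; first by rewrite leqn0 => /eqP -> _; rewrite addn0.
rewrite leq_eqVlt => /orP[/eqP -> _|ij jr]; first by rewrite subnn addn0.
have := f_decr j jr; have := IHj ij (ltnW jr); lia.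
Qed.

Lemma increasing_gap r (f : nat -> nat) : (forall i, (i < r)%N -> (f i < f i.+1)%N) ->
  forall i j, (i <= j)%N -> (j <= r)%N -> (f i + (j - i) <= f j)%N.
Proof.
move=> f_incr i; elim=> [|j IHj]; first by rewrite leqn0 => /eqP -> _; rewrite addn0.
rewrite leq_eqVlt => /orP[/eqP -> _|ij jr]; first by rewrite subnn addn0.
have := f_incr j jr; have := IHj ij (ltnW jr); lia.
Qed.

Arguments decreasing_gap {r f} _ i j _ _.
Arguments increasing_gap {r f} _ i j _ _.

Record staircase (r : nat) (a b : nat -> nat) : Prop := Staircase {
  staircase_decr : forall i, (i < r)%N -> (a i.+1 < a i)%N;
  staircase_ar : a r = 0%N;
  staircase_b0 : b 0%N = 0%N;
  staircase_incr : forall i, (i < r)%N -> (b i < b i.+1)%N }.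

Section Staircase.
Context (r : nat) (a b : nat -> nat) (ab : staircase r a b).
Let a_decr := staircase_decr ab.
Let a_r := staircase_ar ab.
Let b_0 := staircase_b0 ab.
Let b_incr := staircase_incr ab.

Section Separation.
Context (j : nat) (jr : (j < r)%N)
  (above : forall k i, (k <= j < i)%N -> (i <= r)%N ->
     ((b j.+1 - 1 - b k) * (a j - 1 - a i) < (b i - (b j.+1 - 1)) * (a k - (a j - 1)))%N).

(** Put P = (a_j - 1, b_(j+1) - 1).  The generators with index at most j lie to the
    right of P, the others to its left, and the hypothesis says that every segment joining
    two generators on different sides passes strictly above P.  So the slopes that admit a
    line through P below all generators form a nonempty open interval. *)
Lemma separating_weight : exists p q, [/\ (0 < p)%N, (0 < q)%N, coprime p q &
  forall i, (i <= r)%N ->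
    (weight p q ((a j - 1)%N, (b j.+1 - 1)%N) < weight p q (a i, b i))%N].
Proof.
have aj i : (i <= j)%N -> (a j <= a i)%N.
  by move=> ij; have := decreasing_gap a_decr i j; lia.
have aj' i : (j < i <= r)%N -> (a i < a j)%N.
  by case/andP=> ji ir; have := decreasing_gap a_decr j i; lia.
have bj i : (i <= j)%N -> (b i < b j.+1)%N.
  by move=> ij; have := increasing_gap b_incr i j.+1; lia.
have bj' i : (j < i <= r)%N -> (b j.+1 <= b i)%N.
  by case/andP=> ji ir; have := increasing_gap b_incr j.+1 i; lia.
have aj0 : (0 < a j)%N by have := a_decr jr; lia.
have bj0 : (0 < b j.+1)%N by have := bj j (leqnn j); lia.
(* Horizontal and vertical distances from P: n1, u2 to the right, n2, u1 to the left. *)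
pose n1 k := (a k - (a j - 1))%N; pose u2 k := (b j.+1 - 1 - b k)%N.
pose n2 i := (a j - 1 - a (i + j.+1))%N; pose u1 i := (b (i + j.+1) - (b j.+1 - 1))%N.
have n1_gt0 k : (k <= j)%N -> (0 < n1 k)%N by move/aj; rewrite /n1; lia.
have u1_gt0 i : (i <= r - j.+1)%N -> (0 < u1 i)%N.
  by move=> le; have := bj' (i + j.+1)%N; rewrite /u1; lia.
have [k kj kmax] := max_ratio u2 n1_gt0.
have [i ir imax] := max_ratio n2 u1_gt0.
have lt k' i' : (k' <= j)%N -> (i' <= r - j.+1)%N -> (u2 k' * n2 i' < u1 i' * n1 k')%N.
  by move=> k'j i'r; apply: above; lia.
(* The mediant of the steepest right slope u2/n1 and the flattest left slope u1/n2. *)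
pose p := (u2 k + u1 i)%N; pose q := (n1 k + n2 i)%N.
have p0 : (0 < p)%N by have := u1_gt0 i ir; rewrite /p; lia.
have q0 : (0 < q)%N by have := n1_gt0 k kj; rewrite /q; lia.
have g0 : (0 < gcdn p q)%N by rewrite gcdn_gt0 p0.
have pE : p = (p %/ gcdn p q * gcdn p q)%N by rewrite divnK ?dvdn_gcdl.
have qE : q = (q %/ gcdn p q * gcdn p q)%N by rewrite divnK ?dvdn_gcdr.
exists (p %/ gcdn p q)%N, (q %/ gcdn p q)%N; split.
- by rewrite divn_gt0 // dvdn_leq ?dvdn_gcdl.
- by rewrite divn_gt0 // dvdn_leq ?dvdn_gcdr.
- by rewrite /coprime -(eqn_pmul2r g0) muln_gcdl -pE -qE mul1n.
- move=> l lr; rewrite -(ltn_pmul2r g0).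
  have wE c d : (weight (p %/ gcdn p q) (q %/ gcdn p q) (c, d) * gcdn p q = p * c + q * d)%N.
    by rewrite /weight /= mulnDl mulnAC -pE mulnAC -qE.
  rewrite !wE; have [lj|jl] := leqP l j.
    have := kmax l lj; have := lt l i lj ir; have := aj l lj; have := bj l lj.
    have -> : a l = (n1 l + (a j - 1))%N by have := aj l lj; rewrite /n1; lia.
    have -> : (b j.+1 - 1 = u2 l + b l)%N by have := bj l lj; rewrite /u2; lia.
    by move=> _ _; rewrite /p /q; nia.
  have lE : l = (l - j.+1 + j.+1)%N by lia.
  have lr' : (l - j.+1 <= r - j.+1)%N by lia.
  have := imax _ lr'; have := lt k _ kj lr'.
  have -> : (a j - 1 = n2 (l - j.+1) + a l)%N.
    by have := aj' l; rewrite /n2 -lE; lia.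
  have -> : b l = (u1 (l - j.+1) + (b j.+1 - 1))%N.
    by have := bj' l; rewrite /u1 -lE; lia.
  by rewrite /p /q; nia.
Qed.

End Separation.

Context (R : idomainType) (x y : R) (xyP : parameters x y).
Local Notation I := (monomial_ideal x y a b r).

Lemma monomial_idealE : I = monomials_ideal x y [set (a i, b i) | i in [set i | (i <= r)%N]].
Proof.
rewrite /monomial_ideal /monomials_ideal; congr (gen_ideal R _).
by rewrite image_comp.
Qed.

Lemma generator_mem i : (i <= r)%N -> x ^+ a i * y ^+ b i \in I.
Proof. by move=> ir; apply: mem_gen_ideal; exists i. Qed.

(** I is the intersection of the ideals (x^(a_j), y^(b_(j+1))) at the inner corners of
    its staircase: the first j + 1 of them meet in the ideal generated by the
    monomials of index at most j and y^(b_(j+1)). *)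
Lemma mem_staircase t :
  (forall j, (j < r)%N -> exists c d, t = c * x ^+ a j + d * y ^+ b j.+1) -> (0 < r)%N ->
  t \in I.
Proof.
move=> tQ r0.
pose T j := gen_ideal R [set x ^+ a i * y ^+ b i | i in [set i | (i < j)%N]].
have step j : (0 < j <= r)%N -> exists s c, s \in T j /\ t = s + c * y ^+ b j.
  elim: j => // j IHj /=; case: (posnP j) => [-> _|j0 jr].
    have [c [d tE]] := tQ _ r0; exists (c * x ^+ a 0%N), d; split=> //.
    by apply/gen_idealMl/mem_gen_ideal; exists 0%N => //; rewrite b_0 mulr1.
  have [|s [c [sT tE]]] := IHj; first by rewrite j0 ltnW.
  have [c' [d' tE']] := tQ _ jr.
  have [f sE] : divs (x ^+ a j) s.
    move: s sT {tE}; apply: gen_ideal_min; first by exists 0; ring.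
      by move=> w s s' ds ds'; apply: divsD => //; apply: divsMl.
    move=> _ [i /= ij <-]; rewrite mulrC; apply: divsMl; apply: divs_exp.
    by have := decreasing_gap a_decr i j; lia.
  have bjE : b j.+1 = (b j + (b j.+1 - b j))%N by have := b_incr jr; lia.
  have [g gE] : divs (x ^+ a j) (c - d' * y ^+ (b j.+1 - b j)).
    apply: (param_regular xyP (j := b j)); exists (c' - f).
    rewrite mulrBr mulrCA -exprD -bjE.
    have -> : y ^+ b j * c = t - s by rewrite tE; ring.
    by rewrite tE' sE; ring.
  exists (s + g * (x ^+ a j * y ^+ b j)), d'; split.
    apply: gen_idealD.
      apply: (@gen_ideal_sub R _ _ _ s sT) => _ [i ij <-]; apply: mem_gen_ideal.
      by exists i => //=; apply: ltnW.
    by apply/gen_idealMl/mem_gen_ideal; exists j => /=.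
  have -> : t = s + (c - d' * y ^+ (b j.+1 - b j)) * y ^+ b j
      + d' * (y ^+ b j * y ^+ (b j.+1 - b j)) by rewrite tE; ring.
  by rewrite gE -exprD -bjE; ring.
have [|s [c [sT ->]]] := step r; first by rewrite r0 leqnn.
apply: gen_idealD.
  apply: (@gen_ideal_sub R _ _ _ s sT) => _ [i ir <-]; exact/generator_mem/ltnW.
by apply: gen_idealMl; have := generator_mem (leqnn r); rewrite a_r mul1r.
Qed.

Context (I_complete : complete_ideal I).

Lemma ideal_exp_prod (J : {pred R}) n (u : 'I_n -> R) :
  (forall i, u i \in J) -> \prod_(i < n) u i \in ideal_exp J n.
Proof. by move=> uJ; apply: mem_gen_ideal; exists u. Qed.

(** A monomial on or above the segment joining two generators is integral over I:
    its power of exponent n1 + n2 is a multiple of a product of n1 + n2 generators. *)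
Lemma complete_monomial i k n1 n2 c d : (i <= r)%N -> (k <= r)%N -> (0 < n1 + n2)%N ->
  (n1 * a i + n2 * a k <= (n1 + n2) * c)%N -> (n1 * b i + n2 * b k <= (n1 + n2) * d)%N ->
  x ^+ c * y ^+ d \in I.
Proof.
move=> ir kr n0 lea leb; apply/I_complete; set z := x ^+ c * y ^+ d.
set n := (n1 + n2)%N in n0 lea leb.
have zI : - z ^+ n \in ideal_exp I n.
  pose u (l : 'I_(n1 + n2)) := if (l < n1)%N then x ^+ a i * y ^+ b i else x ^+ a k * y ^+ b k.
  have uI l : u l \in I by rewrite /u; case: ifP => _; apply: generator_mem.
  have uE : \prod_l u l = (x ^+ a i * y ^+ b i) ^+ n1 * (x ^+ a k * y ^+ b k) ^+ n2.
    rewrite big_split_ord /=; congr (_ * _).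
      rewrite (eq_bigr (fun=> x ^+ a i * y ^+ b i)) ?prodr_const ?card_ord // => l _.
      by rewrite /u /= ltn_ord.
    rewrite (eq_bigr (fun=> x ^+ a k * y ^+ b k)) ?prodr_const ?card_ord // => l _.
    by rewrite /u /= ltnNge leq_addr.
  have -> : - z ^+ n = - (x ^+ (n * c - (n1 * a i + n2 * a k)) *
                          y ^+ (n * d - (n1 * b i + n2 * b k)))
      * \prod_l u l.
    rewrite uE /z !exprMn -!exprM mulNr; congr (- _).
    have split_exp (w : R) m m1 m2 : (n1 * m1 + n2 * m2 <= n * m)%N ->
      w ^+ (m * n) = w ^+ (n * m - (n1 * m1 + n2 * m2)) * w ^+ (m1 * n1) * w ^+ (m2 * n2).
      by move=> le; rewrite -!exprD; congr (_ ^+ _); lia.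
    by rewrite (split_exp x _ _ _ lea) (split_exp y _ _ _ leb); ring.
  by apply/gen_idealMl/ideal_exp_prod.
exists n, (fun l => if l == n then - z ^+ n else 0); split=> // [l _|].
  by case: eqP => [->|_] //; apply: gen_ideal0.
rewrite (big_cat_nat _ (n := n)) //= big_nat1 eqxx subnn mulr1 big_nat_cond big1 ?add0r ?subrr //.
by move=> l; case: eqP => [->|_ _]; rewrite ?ltnn ?andbF ?mul0r.
Qed.

(** The monomial valuation of the weight that separates a missed corner
    (x^(a_j), y^(b_(j+1))) from I: if the value of t exceeded the weight of the monomial
    P just below the corner, t would be a combination of monomials that do not divide P,
    and these all lie in the corner ideal. *)
Lemma not_mem_valuation t : (0 < r)%N -> t \notin I ->
  exists w : {fraction R} -> int, [/\ discrete_valuation w,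
    forall s, s != 0 -> 0 <= w (FracField.tofrac s) &
    exists2 n, w (FracField.tofrac t) < n &
      forall s, s \in I -> s != 0 -> n <= w (FracField.tofrac s)].
Proof.
move=> r0 tI.
have t0 : t != 0 by apply: contraNneq tI => ->; apply: gen_ideal0.
have [j [jr tQ]] : exists j, (j < r)%N /\
    ~ (exists c d, t = c * x ^+ a j + d * y ^+ b j.+1).
  apply: contrapT => nj; move/negP: tI; apply; apply: mem_staircase => // j jr.
  by apply: contrapT => nt; apply: nj; exists j.
have aj0 : (0 < a j)%N by have := a_decr jr; lia.
have bj0 : (0 < b j.+1)%N by have := b_incr jr; lia.
have PI : x ^+ (a j - 1) * y ^+ (b j.+1 - 1) \notin I.
  apply/negP; rewrite monomial_idealE => PI.
  have [] := unit_monomial_mem xyP (mu := ((a j - 1)%N, (b j.+1 - 1)%N)) (unitr1 _)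
    (S := [set (a i, b i) | i in [set i | (i <= r)%N]]).
    by rewrite mul1r.
  move=> _ [[i /= ir <-] /= le1 le2]; have [ij|ji] := leqP i j.
    by have := decreasing_gap a_decr i j; lia.
  by have := increasing_gap b_incr j.+1 i; lia.
have [|p [q [p0 q0 pq wlt]]] := separating_weight jr.
  move=> k i /andP[kj ji] ir; rewrite ltnNge; apply: contraNN PI => le.
  have h1 : (a j <= a k)%N.
    by have := decreasing_gap a_decr k j; lia.
  have h2 : (a i < a j)%N.
    by have := decreasing_gap a_decr j i; lia.
  have h3 : (b k < b j.+1)%N.
    by have := increasing_gap b_incr k j.+1; lia.
  have h4 : (b j.+1 <= b i)%N.
    by have := increasing_gap b_incr j.+1 i; lia.
  apply: (@complete_monomial i k (a k - (a j - 1)) (a j - 1 - a i)); try lia.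
  - nia.
  - nia.
have [v vv vE] := weight_valuation xyP p0 q0 pq.
have [w dw wE] := nat_valuation_extends vv.
exists w; split=> // [s s0|]; first by rewrite wE.
set P := ((a j - 1)%N, (b j.+1 - 1)%N) in wlt.
exists (weight p q P).+1%:Z.
  rewrite wE // ltz_nat ltnS leqNgt; apply/negP; rewrite vE // => tw; apply: tQ.
  have [|c [d tE]] := monomials_ideal_powers (mu := P) _ tw.
    move=> nu /= lt.
    have [le1|] := leqP nu.1 P.1; last by left.
    have [le2|] := leqP nu.2 P.2; last by right.
    by have [] := weight_divides p0 q0 le1 le2; lia.
  by exists c, d; rewrite tE /P /= !subn1 !prednK.
move=> s sI s0; rewrite wE // lez_nat vE //; move: sI; rewrite monomial_idealE.
by apply: monomials_idealS => _ [i ir <-]; apply: wlt.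
Qed.

End Staircase.

(** * The module as the preimage of the ideal *)

Section HilbertBurch.
Context (R : comNzRingType) (x y : R) (e : nat).
Implicit Types (u v : 'rV[R]_e).

(** The signed maximal minors of the matrix with rows g_1, ..., g_(e-1). *)
Definition hb_column : 'cV[R]_e := \col_(k < e) (x ^+ (e - 1 - k) * (- y) ^+ k).

Definition hb_map v : R := (v *m hb_column) 0 0.

Lemma hb_mapE v : hb_map v = \sum_(k < e) v 0 k * (x ^+ (e - 1 - k) * (- y) ^+ k).
Proof. by rewrite /hb_map mxE; apply: eq_bigr => k _; rewrite mxE. Qed.

Lemma hb_mapD u v : hb_map (u + v) = hb_map u + hb_map v.
Proof. by rewrite /hb_map mulmxDl mxE. Qed.

Lemma hb_mapZ c v : hb_map (c *: v) = c * hb_map v.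
Proof. by rewrite /hb_map -scalemxAl mxE. Qed.

Lemma hb_map_row n (D : 'M[R]_(n, e)) i : hb_map (row i D) = (D *m hb_column) i 0.
Proof. by rewrite /hb_map -row_mul [LHS]mxE. Qed.

Lemma hb_map_eps j : (0 < j <= e)%N -> hb_map (eps R e j) = x ^+ (e - j) * (- y) ^+ (j - 1).
Proof.
move=> je; have je' : (j.-1 < e)%N by lia.
rewrite hb_mapE (bigD1 (Ordinal je')) //= big1 => [|k kj].
  rewrite mxE /= prednK ?eqxx ?mul1r; last by lia.
  by rewrite addr0; congr (_ ^+ _ * _ ^+ _); lia.
rewrite mxE; have -> : (k.+1 == j) = false; last by rewrite mul0r.
apply: contraNF kj => /eqP kj; apply/eqP/val_inj => /=; lia.
Qed.

Lemma hb_map_g i : (1 <= i <= e - 1)%N -> hb_map (gen_g x y e i) = 0.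
Proof.
move=> ie; rewrite hb_mapD !hb_mapZ !hb_map_eps; try lia.
have -> : (e - i = (e - i.+1).+1)%N by lia.
have -> : (i.+1 - 1 = (i - 1).+1)%N by lia.
by rewrite !exprS; ring.
Qed.

Lemma epsE j (k : 'I_e) : eps R e j 0 k = (k.+1 == j)%:R.
Proof. by rewrite mxE. Qed.

Lemma gen_gE i (k : 'I_e) :
  gen_g x y e i 0 k = y * (k.+1 == i)%:R + x * (k == i :> nat)%:R.
Proof. by rewrite !mxE eqSS. Qed.

End HilbertBurch.

Arguments hb_column {R} x y e.
Arguments hb_map {R} x y {e} v.

Section Module.
Context (R : idomainType) (x y : R) (xyP : parameters x y) (r e : nat) (a b : nat -> nat)
  (ab : staircase r a b)
  (e_bounds : (2 <= e <= r)%N) (a_e : a (r - e + 2)%N = (e - 2)%N).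
Let a_decr := staircase_decr ab.
Let a_r := staircase_ar ab.
Let b_0 := staircase_b0 ab.
Let b_incr := staircase_incr ab.
Local Notation I := (monomial_ideal x y a b r).
Local Notation M := (monomial_module x y a b r e).
Implicit Types (u v : 'rV[R]_e).

Lemma tail_exponent i : (0 < i < e)%N -> a (r - e + 1 + i)%N = (e - 1 - i)%N.
Proof.
move=> ie; have h1 := decreasing_gap a_decr (r - e + 2)%N (r - e + 1 + i)%N.
have h2 := decreasing_gap a_decr (r - e + 1 + i)%N r; lia.
Qed.

Lemma head_exponent i : (i <= r - e + 1)%N -> (e - 1 + (r - e + 1 - i) <= a i)%N.
Proof.
move=> ir; have h1 := decreasing_gap a_decr i (r - e + 1)%N.
have h2 := @a_decr (r - e + 1)%N; have E : (r - e + 1).+1 = (r - e + 2)%N by lia.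
by rewrite E in h2; lia.
Qed.

Lemma index_le_b i : (i <= r)%N -> (i <= b i)%N.
Proof. by move=> ir; have := increasing_gap b_incr 0%N i; lia. Qed.

Lemma hb_map_f i : (i <= r - e + 1)%N -> hb_map x y (gen_f x y a b e i) = x ^+ a i * y ^+ b i.
Proof.
move=> ir; rewrite hb_mapZ hb_map_eps ?subnn ?mulr1; last by lia.
rewrite mulrAC -exprD /aprime subnK //.
by have := head_exponent ir; lia.
Qed.

Lemma hb_map_h i : (1 <= i <= e - 1)%N -> hb_map x y (gen_h y b r e i) =
  (-1) ^+ i * (x ^+ a (r - e + 1 + i)%N * y ^+ b (r - e + 1 + i)%N).
Proof.
move=> ie; rewrite hb_mapZ hb_map_eps; last by lia.
have ib : (i <= b (r - e + 1 + i))%N by have := @index_le_b (r - e + 1 + i)%N; lia.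
rewrite tail_exponent; last by lia.
have -> : (e - i.+1 = e - 1 - i)%N by lia.
have -> : (i.+1 - 1 = i)%N by lia.
have -> : y ^+ b (r - e + 1 + i)%N = y ^+ cexp b r e i * y ^+ i.
  by rewrite -exprD /cexp subnK.
by rewrite [(- y) ^+ _]exprNn; ring.
Qed.

Lemma gen_f_mem i : (i <= r - e + 1)%N -> gen_f x y a b e i \in M.
Proof. by move=> ir; apply: mem_span; left; left; exists i. Qed.

Lemma gen_g_mem i : (1 <= i <= e - 1)%N -> gen_g x y e i \in M.
Proof. by move=> ir; apply: mem_span; left; right; exists i. Qed.

Lemma gen_h_mem i : (1 <= i <= e - 1)%N -> gen_h y b r e i \in M.
Proof. by move=> ir; apply: mem_span; right; exists i. Qed.

Lemma module_min (S : set 'rV[R]_e) : S 0 ->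
  (forall c u v, S u -> S v -> S (c *: u + v)) ->
  (forall i, (i <= r - e + 1)%N -> S (gen_f x y a b e i)) ->
  (forall i, (1 <= i <= e - 1)%N -> S (gen_g x y e i)) ->
  (forall i, (1 <= i <= e - 1)%N -> S (gen_h y b r e i)) ->
  forall v, v \in M -> S v.
Proof.
move=> S0 Sl Sf Sg Sh; apply: span_min => //.
by move=> _ [[[i ir <-]|[i ie <-]]|[i ie <-]]; [apply: Sf|apply: Sg|apply: Sh].
Qed.

(** Clear the entries from left to right.  If v starts with k zeros, the terms
    after the k-th in pi(v) = 0 are divisible by y^(k+1), so y divides the entry v_k and a
    multiple of g_(k+1) removes it. *)
Lemma hb_map_kernel v : hb_map x y v = 0 -> v \in M.
Proof.
have [x0 y0] := param_neq0 xyP.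
suff ker n : forall k v, (e - k <= n)%N -> (forall j : 'I_e, (j < k)%N -> v 0 j = 0) ->
    hb_map x y v = 0 -> v \in M by apply: (ker e 0%N) => //; rewrite subn0.
elim: n => [|n IHn] k {}v kn vk hv.
  suff -> : v = 0 by apply: rpred0.
  by apply/rowP => j; rewrite vk ?mxE //; have := ltn_ord j; lia.
have [ek|ke] := leqP e k; first by apply: (IHn k) => //; lia.
pose k' := Ordinal ke.
have hvE : v 0 k' * (x ^+ (e - 1 - k) * (- y) ^+ k) =
    - \sum_(j < e | (k < j)%N) v 0 j * (x ^+ (e - 1 - j) * (- y) ^+ j).
  move: (hv); rewrite hb_mapE (bigD1 k') //= => /eqP; rewrite addr_eq0 => /eqP ->; congr (- _).
  rewrite (bigID (fun j : 'I_e => (k < j)%N)) /= [X in _ + X]big1 ?addr0.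
    by apply: eq_bigl => j; rewrite -val_eqE /=; lia.
  move=> j; rewrite -val_eqE /= => jk; rewrite vk ?mul0r //; lia.
(* At the last position there is no g left, but pi(v) has v_k as its only term. *)
have [k_last|k_lt] : (k = e.-1)%N \/ (k.+1 < e)%N by lia.
  apply: (IHn k.+1); [lia| |done] => j jk.
  have [jk'|->] : (j < k)%N \/ j = k'.
  - by have [->|] := eqVneq j k'; [right|rewrite -val_eqE /=; left; lia].
  - exact: vk.
  apply/eqP; move: hvE; rewrite big1 => [/eqP|i]; last by have := ltn_ord i; lia.
  by rewrite oppr0 mulf_eq0 mulf_eq0 !expf_eq0 oppr_eq0 (negPf x0) (negPf y0) !andbF !orbF.
have [q vkE] : divs (y ^+ 1) (v 0 k').
  have yk0 : (- y) ^+ k != 0 by rewrite expf_neq0 ?oppr_eq0.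
  have [d dE] : exists d, v 0 k' * (x ^+ (e - 1 - k) * (- y) ^+ k) = d * y * (- y) ^+ k.
    have [d dE] : divs (y * (- y) ^+ k) (v 0 k' * (x ^+ (e - 1 - k) * (- y) ^+ k)).
      rewrite hvE; apply: divsN; apply: (big_ind (divs _)); first by exists 0; ring.
        exact: divsD.
      move=> j kj; exists (- v 0 j * x ^+ (e - 1 - j) * (- y) ^+ (j - k.+1)).
      have -> : (- y) ^+ j = (- y) ^+ (j - k.+1) * (- y) ^+ k.+1 by rewrite -exprD subnK.
      by rewrite exprS; ring.
    by exists d; rewrite dE mulrA.
  apply: (param_regular (parametersC xyP) (i := 1) (j := e - 1 - k)); exists d.
  by apply: (mulIf yk0); rewrite expr1 -dE; ring.
have g_mem : gen_g x y e k.+1 \in M by apply: gen_g_mem; lia.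
rewrite -(subrK (q *: gen_g x y e k.+1) v) rpredD ?rpredZ //.
apply: (IHn k.+1); first lia; last first.
  by rewrite -scaleN1r hb_mapD !hb_mapZ hv hb_map_g ?mulr0 ?addr0 //; lia.
move=> j jk; have -> : (v - q *: gen_g x y e k.+1) 0 j = v 0 j - q * gen_g x y e k.+1 0 j.
  by rewrite !mxE.
rewrite gen_gE.
have [jk'|jE] : (j < k)%N \/ j = k'.
- by have [->|] := eqVneq j k'; [right|rewrite -val_eqE /=; left; lia].
- rewrite vk //; have -> : (j.+1 == k.+1) = false by lia.
  have -> : (j == k.+1 :> nat) = false by lia.
  rewrite /= !mulr0n; ring.
rewrite jE /= eqxx; have -> : (k == k.+1) = false by lia.
by rewrite /= mulr0n mulr1n vkE expr1; ring.
Qed.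

(** The sign of pi(h_i) is absorbed into the preimage. *)
Lemma hb_map_surjective z : z \in I -> exists v, v \in M /\ hb_map x y v = z.
Proof.
move: z; apply: gen_ideal_min.
- by exists 0; rewrite rpred0 /hb_map mul0mx mxE.
- move=> c s t [u [uM <-]] [w [wM <-]]; exists (c *: u + w).
  by rewrite rpredD ?rpredZ // hb_mapD hb_mapZ.
- move=> _ [i /= ir <-]; have [ie|ie] := leqP i (r - e + 1)%N.
    by exists (gen_f x y a b e i); rewrite gen_f_mem // hb_map_f.
  exists ((-1) ^+ (i - (r - e + 1)) *: gen_h y b r e (i - (r - e + 1))).
  have ie' : (1 <= i - (r - e + 1) <= e - 1)%N by lia.
  split; first by rewrite rpredZ ?gen_h_mem.
  rewrite hb_mapZ hb_map_h // subnKC; last lia.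
  by rewrite mulrA -exprD addnn -mul2n exprM sqrrN !expr1n mul1r.
Qed.

(** Two vectors with the same image under pi differ by an element of its kernel, which
    M contains. *)
Lemma mem_module v : (v \in M) = (hb_map x y v \in I).
Proof.
apply/idP/idP.
  move: v; apply: module_min.
  - by rewrite /hb_map mul0mx mxE gen_ideal0.
  - move=> c u v uI vI; rewrite hb_mapD hb_mapZ.
    by apply: gen_idealD => //; apply: gen_idealMl.
  - move=> i ir; rewrite hb_map_f //; apply: mem_gen_ideal; exists i => //=; lia.
  - by move=> i ie; rewrite hb_map_g // gen_ideal0.
  - move=> i ie; rewrite hb_map_h //; apply: gen_idealMl.
    by apply: mem_gen_ideal; exists (r - e + 1 + i)%N => //=; lia.
move=> /hb_map_surjective [u [uM uv]].
rewrite -(subrK u v) rpredD //; apply: hb_map_kernel.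
by rewrite -scaleN1r hb_mapD hb_mapZ uv; ring.
Qed.

End Module.

(** * Integral closedness and rank *)

Section Closed.
Context (R : idomainType) (x y : R) (xyP : parameters x y) (r e : nat) (a b : nat -> nat)
  (ab : staircase r a b) (e_bounds : (2 <= e <= r)%N) (a_e : a (r - e + 2)%N = (e - 2)%N).
Local Notation I := (monomial_ideal x y a b r).
Local Notation M := (monomial_module x y a b r e).
Local Notation K := {fraction R}.
Local Notation tofrac := (@FracField.tofrac R).
Implicit Types (u v : 'rV[R]_e).

Lemma x_power_mem v : x ^+ a 0%N *: v \in M.
Proof.
rewrite (mem_module xyP ab e_bounds a_e) hb_mapZ; apply: gen_idealMr.
by apply: mem_gen_ideal; exists 0%N => //; rewrite (staircase_b0 ab) mulr1.
Qed.

Lemma y_power_mem v : y ^+ b r *: v \in M.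
Proof.
rewrite (mem_module xyP ab e_bounds a_e) hb_mapZ; apply: gen_idealMr.
by apply: mem_gen_ideal; exists r => /=; rewrite ?(staircase_ar ab) ?mul1r.
Qed.

Lemma frac_module_full : frac_module M = setT.
Proof.
have [x0 _] := param_neq0 xyP.
have t0 : tofrac (x ^+ a 0%N) != 0 by rewrite tofrac_eq0 expf_neq0.
apply/seteqP; split=> // v _.
exists e, (fun k => v 0 k / tofrac (x ^+ a 0%N)),
  (fun k => map_mx tofrac (x ^+ a 0%N *: delta_mx 0 k)); split.
  by move=> k; split=> //; exists (x ^+ a 0%N *: delta_mx 0 k) => //; apply: x_power_mem.
rewrite {1}[v]row_sum_delta; apply: eq_bigr => k _.
rewrite map_mxZ scalerA mulfVK //; congr (_ *: _).
by apply/matrixP => i j; rewrite !mxE rmorph_nat.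
Qed.

Lemma module_has_rank : has_rank M e.
Proof.
exists fullv; last by rewrite dimvf /dim /= mul1n.
by rewrite frac_module_full; apply/seteqP; split=> // v _; rewrite /= memvf.
Qed.

Lemma frac_image_span v (V : set K) : range tofrac `<=` V -> v \in M ->
  lincomb V (frac_image M) (map_mx tofrac v).
Proof.
move=> VR vM; exists 1%N, (fun=> 1), (fun=> map_mx tofrac v).
split=> [_|]; last by rewrite big_ord1 scale1r.
by split; [apply: VR; exists 1; rewrite ?rmorph1|exists v].
Qed.

(** M is the preimage of I under pi, and both R in K and I in R are detected by
    discrete valuation rings. *)
Lemma module_integrally_closed : complete_ideal I -> integrally_closed M.
Proof.
move=> I_complete; apply/seteqP; split=> [f [_ fV]|_ [v vM <-]]; last first.
  by split=> [|V dV VR]; [rewrite frac_module_full|apply: frac_image_span].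
have fR k : range tofrac (f 0 k).
  apply: (mem_range_of_dvr xyP) => V dvrV VR; have [w dw VE] := dvrV.
  have [n [c [s [csP ->]]]] := fV _ dvrV VR; rewrite VE summxE.
  apply: (val_ge_sum dw) => i _; rewrite mxE.
  have [Vc [v vM <-]] := csP i; apply: (val_geMl dw); first by move: Vc; rewrite VE.
  by have := VR (tofrac (v 0 k)); rewrite VE mxE; apply; exists (v 0 k).
have [u uE] : exists u, map_mx tofrac u = f.
  have /choice [u uP] k : exists s, tofrac s = f 0 k by have [s _ sE] := fR k; exists s.
  by exists (\row_k u k); apply/rowP => k; rewrite !mxE.
exists u => //=; rewrite (mem_module xyP ab e_bounds a_e).
apply/negPn/negP => uI.
have r0 : (0 < r)%N by lia.
have [w [dw w_ge0 [n wu wI]]] := not_mem_valuation ab xyP I_complete r0 uI.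
have VR : range tofrac `<=` valuation_subring w.
  by move=> _ [s _ <-]; rewrite /valuation_subring /= tofrac_eq0 => /w_ge0.
have [|N [c [s [csP fE]]]] := fV _ _ VR; first by exists w.
have /choice [v vP] i : exists v, v \in M /\ map_mx tofrac v = s i.
  by have [_ [v vM vE]] := csP i; exists v.
have hb_map_frac z : tofrac (hb_map x y z) =
    (map_mx tofrac z *m map_mx tofrac (hb_column x y e)) 0 0.
  by rewrite -map_mxM mxE.
have : val_ge w n (tofrac (hb_map x y u)).
  rewrite hb_map_frac uE fE mulmx_suml summxE; apply: (val_ge_sum dw) => i _.
  have [viM viE] := vP i; have [Vc _] := csP i.
  rewrite -viE -scalemxAl mxE -hb_map_frac; apply: (val_geMl dw) => //.
  rewrite /val_ge /= tofrac_eq0; apply: wI.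
  by move: viM; rewrite (mem_module xyP ab e_bounds a_e).
rewrite /val_ge /= tofrac_eq0 => /(_ _); rewrite leNgt wu => h; apply: notF; apply: h.
by apply: contraNneq uI => ->; apply: gen_ideal0.
Qed.

End Closed.

(** * Fitting ideals and the double dual *)

Section Fitting.
Context (R : comNzRingType) (e : nat) (M : submodClosed 'rV[R]_e).

Definition minors_ideal : {pred R} :=
  gen_ideal R [set \det D | D in [set D : 'M[R]_e | forall i, row i D \in M]].

(** Expand along the columns of X, one after another. *)
Lemma det_row_mx_minors n (X : 'M[R]_(n + e, n)) (P : 'M[R]_(n + e, e)) :
  (forall i, row i P \in M) -> \det (row_mx X P) \in minors_ideal.
Proof.
elim: n X P => [|n IHn] X P PM.
  apply: mem_gen_ideal; exists P => //; congr (\det _); apply/matrixP => i j.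
  by rewrite mxE; case: splitP => [[]|k] //= /val_inj ->.
rewrite (expand_det_col _ (lshift e ord0)); apply: gen_ideal_sum => i _.
rewrite /cofactor; do 2!apply: gen_idealMl.
rewrite col'Kl row'_row_mx; apply: IHn => k.
by have := PM (lift i k); congr (_ \in M); apply/rowP => j; rewrite !mxE.
Qed.

(** Fitting's lemma for a free module.  If A is a matrix of relations between
    generators u = U eps, and eps = B u modulo S, then det A is unchanged by adjoining the
    rows of (-B, 1) and adding to the last e columns the combination of the first ones given
    by U; these last columns then have rows in M. *)
Lemma fitting0_free (N : lmodType R) (f : {linear N -> 'rV[R]_e}) (S : set N) :
  (forall k, exists h, f h = delta_mx 0 k) -> (forall h, S h <-> f h \in M) ->
  fitting0 S = [set` minors_ideal].
Proof.
move=> /choice [E EP] SM; apply/seteqP; split=> z /=; last first.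
  move=> zM; exists e, E; split.
    move=> h; exists (fun k => f h 0 k); apply/SM; rewrite linearB linear_sum /=.
    rewrite [X in X - _]row_sum_delta.
    by under [X in _ - X]eq_bigr do rewrite linearZ /= EP; rewrite subrr rpred0.
  apply: (@gen_ideal_sub R _ _ _ z zM) => _ [D DM <-]; apply: mem_gen_ideal.
  exists D => // i; apply/SM; rewrite linear_sum /=.
  under eq_bigr do rewrite linearZ /= EP.
  have -> : \sum_j D i j *: delta_mx 0 j = row i D; last exact: DM.
  by rewrite [RHS]row_sum_delta; apply: eq_bigr => j _; rewrite mxE.
case=> n [u [uS]]; apply: gen_ideal_sub => _ [A AS <-].
have /choice [C CP] k := uS (E k).
pose U := \matrix_(j < n) f (u j); pose B := \matrix_(k, j) C k j : 'M_(e, n).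
have rowU m (Q : 'M_(m, n)) i : row i (Q *m U) = f (\sum_j Q i j *: u j).
  rewrite row_mul mulmx_sum_row linear_sum; apply: eq_bigr => j _ /=.
  by rewrite linearZ /= rowK mxE.
have -> : \det A = \det (row_mx (col_mx A (- B)) (col_mx (A *m U) (1%:M - B *m U))).
  have -> : row_mx (col_mx A (- B)) (col_mx (A *m U) (1%:M - B *m U)) =
      block_mx A 0 (- B) 1%:M *m block_mx 1%:M U 0 1%:M.
    rewrite mulmx_block !mulmx0 !mulmx1 !addr0 mulNmx [- _ + _]addrC.
    by rewrite block_mxEh.
  by rewrite det_mulmx det_lblock det_ublock !det1 !mulr1.
apply: det_row_mx_minors => i.
have [[j ->]|[k ->]] : (exists j, i = lshift e j) \/ (exists k, i = rshift n k).
  by case: (split_ordP i) => k ->; [left|right]; exists k.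
- by rewrite rowKu rowU; apply/SM/AS.
- rewrite rowKd raddfB /= row1 rowU -EP -linearB /=; apply/SM.
  by under eq_bigr do rewrite mxE; apply: CP.
Qed.

End Fitting.

Section DoubleDual.
Context (R : idomainType) (x y : R) (xyP : parameters x y) (e : nat).
Context (M : submodClosed 'rV[R]_e) (i j : nat).
Hypotheses (xM : forall v, x ^+ i *: v \in M) (yM : forall v, y ^+ j *: v \in M).
Local Notation MM := (submod_type M).

(** The value that the extension must take at eps_k is f(x^i eps_k) / x^i; it is in R
    because y^j f(x^i eps_k) = x^i f(y^j eps_k) and x^i, y^j is a regular sequence. *)
Lemma linear_form_extends (f : MM -> R) :
  (forall c s t, f (c *: s + t) = c * f s + f t) ->
  exists c : 'cV[R]_e, forall s, f s = (val s *m c) 0 0.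
Proof.
move=> f_lin; have [x0 _] := param_neq0 xyP.
have xi0 : x ^+ i != 0 by rewrite expf_neq0.
have f0 : f 0 = 0.
  have := f_lin 1 0 0; rewrite scaler0 addr0 mul1r => /eqP.
  by rewrite -subr_eq0 opprD addNKr oppr_eq0 => /eqP.
have fD s t : f (s + t) = f s + f t by rewrite -[s]scale1r f_lin mul1r scale1r.
have fZ c s : f (c *: s) = c * f s by rewrite -[c *: s]addr0 f_lin f0 addr0.
pose X v := SubmodType (xM v); pose Y v := SubmodType (yM v).
have /choice [c cP] k : exists d, f (X (delta_mx 0 k)) = d * x ^+ i.
  apply: (param_regular xyP (j := j)); exists (f (Y (delta_mx 0 k))).
  rewrite [RHS]mulrC -!fZ; congr f; apply: val_inj => /=.
  by rewrite !scalerA mulrC.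
exists (\col_k c k) => s; apply: (mulfI xi0).
have sE : x ^+ i *: s = \sum_k (val s) 0 k *: X (delta_mx 0 k).
  apply: val_inj; rewrite [RHS]raddf_sum /= [X in _ *: X]row_sum_delta scaler_sumr.
  by apply: eq_bigr => k _; rewrite !scalerA mulrC.
rewrite -fZ sE (big_morph f fD f0) mxE mulr_sumr; apply: eq_bigr => k _.
by rewrite fZ cP [(\col__ _) _ _]mxE; ring.
Qed.

Lemma linear_form_unique (c c' : 'cV[R]_e) :
  (forall s : MM, (val s *m c) 0 0 = (val s *m c') 0 0) -> c = c'.
Proof.
have [x0 _] := param_neq0 xyP.
have xi0 : x ^+ i != 0 by rewrite expf_neq0.
move=> cc'; apply/colP => k; apply: (mulfI xi0).
have := cc' (SubmodType (xM (delta_mx 0 k))).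
by rewrite /= -!scalemxAl -!rowE !mxE.
Qed.

Definition coord_fun (k : 'I_e) (s : MM) : R^o := val s 0 k.

Lemma coord_fun_linear k : linear (coord_fun k).
Proof. by move=> c s t; rewrite /coord_fun /= !mxE. Qed.

HB.instance Definition _ k :=
  GRing.isLinear.Build R MM R^o *:%R (coord_fun k) (coord_fun_linear k).

Definition coord_dual k : dual MM := coord_fun k : {linear MM -> R^o}.

(** A functional on the dual of M is determined by its values at the coordinate forms;
    this identifies the double dual with R^e. *)
Definition bidual_coords (h : dual (dual MM)) : 'rV[R]_e :=
  \row_k dual_fun h (coord_dual k).

Lemma bidual_coords_linear : linear bidual_coords.
Proof. by move=> c h h'; apply/rowP => k; rewrite !mxE. Qed.

HB.instance Definition _ :=
  GRing.isLinear.Build R (dual (dual MM)) 'rV[R]_e *:%R bidual_coords bidual_coords_linear.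

Lemma bidual_coords_eval (s : MM) : bidual_coords (to_double_dual s) = val s.
Proof. by apply/rowP => k; rewrite mxE. Qed.

Lemma dual_column (f : dual MM) : exists c : 'cV[R]_e, forall s, dual_fun f s = (val s *m c) 0 0.
Proof.
by apply: linear_form_extends => c s t; rewrite linearP.
Qed.

Lemma dual_fun_sum (N : lmodType R) (c : 'I_e -> R) (f : 'I_e -> dual N) s :
  dual_fun (\sum_k c k *: f k) s = \sum_k c k * dual_fun (f k) s.
Proof.
by apply: (big_morph (fun g => dual_fun g s)).
Qed.

Lemma bidual_coords_inj : injective bidual_coords.
Proof.
move=> h h' hh'; apply: dualP => f; have [c cP] := dual_column f.
have -> : f = \sum_k c k 0 *: coord_dual k.
  apply: dualP => s; rewrite cP dual_fun_sum mxE; apply: eq_bigr => k _.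
  by rewrite mulrC.
rewrite !linear_sum; apply: eq_bigr => k _; rewrite !linearZ /=; congr (_ * _).
by have /rowP /(_ k) := hh'; rewrite !mxE.
Qed.

Lemma bidual_coords_delta k : exists h, bidual_coords h = delta_mx 0 k.
Proof.
have /choice [c cP] := dual_column.
have c_lin : linear (fun f => c f k 0 : R^o).
  move=> d f f'; have -> : c (d *: f + f') = d *: c f + c f'; last by rewrite !mxE.
  apply: linear_form_unique => s; rewrite -cP mulmxDr -scalemxAr [RHS]mxE.
  by rewrite [(d *: (_ *m _)) 0 0]mxE -!cP.
pose L := GRing.isLinear.Build R (dual MM) R^o *:%R _ c_lin.
pose h : {linear dual MM -> R^o} := HB.pack (fun f => c f k 0 : R^o) L.
exists h; apply/rowP => l; rewrite !mxE eqxx /=.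
have -> : c (coord_dual l) = delta_mx l 0.
  by apply: linear_form_unique => s; rewrite -cP -colE mxE.
by rewrite mxE eqxx andbT eq_sym.
Qed.

Lemma module_ideal_minors : module_ideal MM = [set` minors_ideal M].
Proof.
apply: (@fitting0_free _ _ M _ bidual_coords).
- exact: bidual_coords_delta.
- move=> h; split=> [[s _ <-]|hM] /=; first by rewrite bidual_coords_eval; apply: submod_valP.
  exists (SubmodType hM) => //; apply: bidual_coords_inj; exact: bidual_coords_eval.
Qed.

End DoubleDual.

(** * Idempotents preserving the linear part of M *)

Section Pencil.
Context (R : idomainType) (x y : R) (xyP : parameters x y) (e : nat) (e_gt0 : (0 < e)%N).

(** Modulo m^2 such a vector is a combination of x eps_1 and the vectors g_i; s and t
    are the coefficients of x and y. *)
Definition pencil_shape (v : 'rV[R]_e) : Prop := exists s t : nat -> R,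
  [/\ forall k : 'I_e, v 0 k = x * s k + y * t k,
      forall k, (k.+1 < e)%N -> t k - s k.+1 \isn't a GRing.unit &
      t (e - 1)%N \isn't a GRing.unit].

(** Such a matrix is triangular with invertible diagonal modulo the maximal ideal. *)
Lemma det_unit_mod n (A : 'M[R]_n) : (forall i, A i i \is a GRing.unit) ->
  (forall i j : 'I_n, (i < j)%N -> A i j \isn't a GRing.unit) -> \det A \is a GRing.unit.
Proof.
elim: n A => [|n IHn] A Ad Au; first by rewrite det_mx00 unitr1.
rewrite (expand_det_row _ ord0) big_ord_recl; apply: (param_unitD xyP).
  rewrite unitrM Ad /cofactor unitrM unitrX ?unitrN1 //=.
  apply: IHn => [i|i j ij]; first by rewrite !mxE.
  by rewrite !mxE; apply: Au.
apply: (big_ind (fun s => s \isn't a GRing.unit)) => [||i _]; first by rewrite unitr0.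
  exact: (param_nonunitD xyP).
by rewrite mulrC; apply: nonunitMl; apply: Au.
Qed.

Lemma divs_nonunit (z s : R) : z \isn't a GRing.unit -> divs z s -> s \isn't a GRing.unit.
Proof. by move=> zU [d ->]; apply: nonunitMl. Qed.

Lemma param_nonunit_congr (s t : R) : s - t \isn't a GRing.unit -> t \isn't a GRing.unit ->
  s \isn't a GRing.unit.
Proof. by move=> st tU; rewrite -(subrK t s); apply: (param_nonunitD xyP). Qed.

Lemma eps_delta i (k : 'I_e) : i = k.+1 -> eps R e i = delta_mx 0 k.
Proof. by move=> ->; apply/rowP => j; rewrite !mxE eqxx eqSS. Qed.

(** The entries of g_i phi are y phi_(i,k) + x phi_(i+1,k).  Comparing with the pencil
    shape modulo m gives phi_(i,k) = phi_(i+1,k+1), and zero in the last column except at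
    the corner: phi mod m is lower triangular with constant diagonal q, where q^2 = q.  As
    R is local, phi or 1 - phi is invertible, and an invertible idempotent is 1. *)
Lemma idempotent_trivial (phi : 'M[R]_e) : phi *m phi = phi ->
  (forall i, (1 <= i <= e - 1)%N -> pencil_shape (gen_g x y e i *m phi)) ->
  phi = 0 \/ phi = 1%:M.
Proof.
move=> phi2 phi_shape.
(* Rows and columns of phi indexed by natural numbers. *)
pose o i : 'I_e := insubd (Ordinal e_gt0) i.
have oE (k : 'I_e) : o k = k by apply: valKd.
have oval i : (i < e)%N -> o i = i :> nat by move=> ie; rewrite /o val_insubd ie.
pose F i k := phi (o i) (o k).
have shift i : (i.+1 < e)%N -> exists s t : nat -> R,
    [/\ forall k, (k < e)%N -> F i.+1 k - s k \isn't a GRing.unit,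
        forall k, (k < e)%N -> F i k - t k \isn't a GRing.unit,
        forall k, (k.+1 < e)%N -> t k - s k.+1 \isn't a GRing.unit &
        t (e - 1)%N \isn't a GRing.unit].
  move=> ie; have [|s [t [shapeE tU lU]]] := phi_shape i.+1; first by lia.
  have E k : (k < e)%N -> y * F i k + x * F i.+1 k = x * s k + y * t k.
    move=> ke; have := shapeE (o k); rewrite oval // => <-.
    rewrite /gen_g (@eps_delta i.+1 (o i)) ?oval //; last by lia.
    rewrite (@eps_delta i.+2 (o i.+1)) ?oval //.
    by rewrite mulmxDl -!scalemxAl -!rowE !mxE.
  exists s, t; split=> // k ke; have Ek := E k ke.
    apply: (divs_nonunit (param_nonunit_x (parametersC xyP))).
    apply: (param_regular1 (parametersC xyP)); exists (t k - F i k).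
    have -> : x * (F i.+1 k - s k) = (y * F i k + x * F i.+1 k) - x * s k - y * F i k by ring.
    by rewrite Ek; ring.
  apply: (divs_nonunit (param_nonunit_x xyP)).
  apply: (param_regular1 xyP); exists (s k - F i.+1 k).
  have -> : y * (F i k - t k) = (y * F i k + x * F i.+1 k) - y * t k - x * F i.+1 k by ring.
  by rewrite Ek; ring.
have toeplitz i k : (i.+1 < e)%N -> (k.+1 < e)%N -> F i k - F i.+1 k.+1 \isn't a GRing.unit.
  move=> ie ke; have [s [t [sF tF ts _]]] := shift i ie.
  have -> : F i k - F i.+1 k.+1 =
      (F i k - t k) + (t k - s k.+1) + (-1) * (F i.+1 k.+1 - s k.+1) by ring.
  apply: (param_nonunitD xyP); last by apply: nonunitMl; apply: sF.
  by apply: (param_nonunitD xyP); [apply: tF; lia|apply: ts].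
have last_col i : (i.+1 < e)%N -> F i (e - 1)%N \isn't a GRing.unit.
  move=> ie; have [s [t [_ tF _ tl]]] := shift i ie.
  by apply: param_nonunit_congr tl; apply: tF; lia.
have upper n : forall i k, (e - 1 - k <= n)%N -> (i < k < e)%N -> F i k \isn't a GRing.unit.
  elim: n => [|n IHn] i k kn ik.
    have -> : k = (e - 1)%N by lia.
    by apply: last_col; lia.
  have [ke|ke] : k = (e - 1)%N \/ (k.+1 < e)%N by lia.
    by rewrite ke; apply: last_col; lia.
  by apply: (@param_nonunit_congr _ (F i.+1 k.+1)); [apply: toeplitz|apply: IHn]; lia.
have diag i : (i < e)%N -> F i i - F 0%N 0%N \isn't a GRing.unit.
  elim: i => [|i IHi] ie; first by rewrite subrr unitr0.
  have -> : F i.+1 i.+1 - F 0%N 0%N = (F i i - F 0%N 0%N) + (-1) * (F i i - F i.+1 i.+1) by ring.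
  apply: (param_nonunitD xyP); first by apply: IHi; lia.
  by apply: nonunitMl; apply: toeplitz.
have F00 : F 0%N 0%N * (1 - F 0%N 0%N) \isn't a GRing.unit.
  have := congr1 (fun A : 'M_e => A (o 0%N) (o 0%N)) phi2.
  rewrite mxE (bigD1 (o 0%N)) //= -/(F 0%N 0%N) => E.
  have -> : F 0%N 0%N * (1 - F 0%N 0%N) = \sum_(i < e | i != o 0%N) phi (o 0%N) i * phi i (o 0%N).
    by rewrite mulrBr mulr1 -{1}E; ring.
  apply: (big_ind (fun s => s \isn't a GRing.unit)) => [||i i0]; first by rewrite unitr0.
    exact: (param_nonunitD xyP).
  rewrite mulrC; apply: nonunitMl; rewrite -(oE i).
  apply: (upper e); first by lia.
  have := ltn_ord i; move: i0; rewrite -val_eqE /= oval //; lia.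
have phiE (i j : 'I_e) : phi i j = F i j by rewrite /F !oE.
have upper_phi (i j : 'I_e) : (i < j)%N -> phi i j \isn't a GRing.unit.
  by move=> ij; rewrite phiE; apply: (upper e); have := ltn_ord j; lia.
have [qU|qU] : F 0%N 0%N \isn't a GRing.unit \/ 1 - F 0%N 0%N \isn't a GRing.unit.
  by apply/orP; rewrite -negb_and -unitrM.
- left; have dU : 1%:M - phi \in unitmx.
    apply: det_unit_mod => [i|i j ij]; rewrite !mxE.
      rewrite eqxx -mulN1r; apply: (param_unitD xyP); first exact: unitr1.
      by apply: nonunitMl; rewrite phiE; apply: param_nonunit_congr (diag _ (ltn_ord i)) qU.
    have -> : (i == j) = false by rewrite -val_eqE /=; lia.
    by rewrite add0r -mulN1r; apply: nonunitMl; apply: upper_phi.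
  by rewrite -(mulmxK dU phi) mulmxBr mulmx1 phi2 subrr mul0mx.
- right; have dU : phi \in unitmx.
    apply: det_unit_mod => [i|i j ij]; last exact: upper_phi.
    have -> : phi i i = 1 + ((F i i - F 0%N 0%N) + (-1) * (1 - F 0%N 0%N)) by rewrite phiE; ring.
    apply: (param_unitD xyP); first exact: unitr1.
    by apply: (param_nonunitD xyP); [apply: diag|apply: nonunitMl].
  by rewrite -(mulmxK dU phi) phi2 mulmxV.
Qed.

End Pencil.

(** * The linear part of M and its maximal minors *)

Section Shape.
Context (R : idomainType) (x y : R) (xyP : parameters x y) (r e : nat) (a b : nat -> nat)
  (ab : staircase r a b) (e_bounds : (2 <= e <= r)%N) (a_e : a (r - e + 2)%N = (e - 2)%N).
Context (f0_order : (0 < aprime a e 0)%N)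
  (f_order : forall i, (1 <= i <= r - e + 1)%N -> (2 <= aprime a e i + b i)%N)
  (h_order : forall i, (1 <= i <= e - 1)%N -> (2 <= cexp b r e i)%N).
Local Notation I := (monomial_ideal x y a b r).
Local Notation M := (monomial_module x y a b r e).
Implicit Types (u v : 'rV[R]_e).

Lemma module_pencil_shape v : v \in M -> pencil_shape x y v.
Proof.
have U0 : (0 : R) \isn't a GRing.unit by rewrite unitr0.
have x_exp n z : (0 < n)%N -> z * x ^+ n \isn't a GRing.unit.
  move=> n0; rewrite -(prednK n0) exprSr mulrA.
  by apply: nonunitMl; apply: (param_nonunit_x xyP).
have y_exp n z : (0 < n)%N -> z * y ^+ n \isn't a GRing.unit.
  move=> n0; rewrite -(prednK n0) exprSr mulrA.
  by apply: nonunitMl; apply: (param_nonunit_x (parametersC xyP)).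
(* Vectors divisible by y with quotient in m; this covers f_i for i > 0 and all h_i. *)
have shape_t (t : nat -> R) u : (forall k, t k \isn't a GRing.unit) ->
    (forall k : 'I_e, u 0 k = y * t k) -> pencil_shape x y u.
  move=> tU uE; exists (fun=> 0), t; split=> // [k|k _]; last by rewrite subr0.
  by rewrite uE; ring.
move: v; apply: module_min.
- by apply: (shape_t (fun=> 0)) => // k; rewrite mxE mulr0.
- move=> c u v [s [t [uE tU lU]]] [s' [t' [vE t'U l'U]]].
  exists (fun k => c * s k + s' k), (fun k => c * t k + t' k); split=> [k|k ke|].
  + by rewrite mxE [(c *: u) 0 k]mxE uE vE; ring.
  + have -> : c * t k + t' k - (c * s k.+1 + s' k.+1) = c * (t k - s k.+1) + (t' k - s' k.+1).
      by ring.
    by apply: (param_nonunitD xyP); [apply: nonunitMl; apply: tU|apply: t'U].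
  + by apply: (param_nonunitD xyP) => //; apply: nonunitMl.
- move=> [|i] ir.
    exists (fun k => (k == 0%N)%:R * x ^+ (aprime a e 0 - 1)), (fun=> 0); split=> // [k|k _].
      rewrite mxE epsE eqSS (staircase_b0 ab) mulr1 -{1}(subnK f0_order) exprD expr1; ring.
    by rewrite mul0r subr0.
  have bi : (0 < b i.+1)%N by have := increasing_gap (staircase_incr ab) 0%N i.+1; lia.
  apply: (shape_t (fun k => (k == 0%N)%:R * (x ^+ aprime a e i.+1 * y ^+ (b i.+1 - 1)))) => [k|k].
    have : (2 <= aprime a e i.+1 + b i.+1)%N by apply: f_order.
    case: (posnP (aprime a e i.+1)) => [-> b2|a0 _].
      by rewrite mulrA; apply: y_exp; lia.
    by rewrite [x ^+ _ * _]mulrC mulrA; apply: x_exp.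
  by rewrite mxE epsE eqSS -{1}(subnK bi) exprD expr1; ring.
- move=> i ie.
  exists (fun k => (k == i)%:R), (fun k => (k.+1 == i)%:R); split=> [k|k ke|].
  + by rewrite gen_gE; ring.
  + by rewrite subrr.
  + have -> : ((e - 1).+1 == i) = false by lia.
    by [].
- move=> i ie; have ci := h_order ie.
  apply: (shape_t (fun k => (k == i)%:R * y ^+ (cexp b r e i - 1))) => [k|k].
    by apply: y_exp; lia.
  by rewrite mxE epsE eqSS -{1}(subnK (ltnW ci)) exprD expr1; ring.
Qed.

(** Cramer's rule for matrices with rows in M, applied to the column of the values
    pi(eps_j), gives one inclusion; the matrices with rows v, g_1, ..., g_(e-1) give the other. *)
Lemma minors_ideal_module : complete_ideal I ->
  [set` minors_ideal M] = [set` I].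
Proof.
move=> I_complete; have [x0 y0] := param_neq0 xyP.
have e0 : (0 < e)%N by lia.
have e1 : (e - 1 < e)%N by lia.
pose k0 := Ordinal e0; pose k1 := Ordinal e1.
apply/seteqP; split=> z /=.
  apply: gen_ideal_sub => _ [D DM <-].
  apply/negPn/negP => DI; have r0 : (0 < r)%N by lia.
  have [w [dw w_ge0 [n wD wI]]] := not_mem_valuation ab xyP I_complete r0 DI.
  have D0 : \det D != 0 by apply: contraNneq DI => ->; apply: gen_ideal0.
  have VR s : valuation_subring w (FracField.tofrac s).
    by rewrite /valuation_subring /= tofrac_eq0 => /w_ge0.
  (* The least value on the maximal ideal, which contains all entries of D. *)
  pose mu := Num.min (w (FracField.tofrac x)) (w (FracField.tofrac y)).
  have Dmu i j : val_ge w mu (FracField.tofrac (D i j)).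
    have [s [t [rowE _ _]]] := module_pencil_shape (DM i).
    have := rowE j; rewrite mxE => ->; rewrite rmorphD !rmorphM /=.
    apply: (val_geD dw); rewrite mulrC; apply: (val_geMl dw) => //;
      by move=> _; rewrite /mu ge_min lexx ?orbT.
  have cof_mu i j : val_ge w (mu *+ (e - 1)) (FracField.tofrac (cofactor D i j)).
    rewrite /cofactor rmorphM; apply: (val_geMl dw); first exact: VR.
    rewrite /determinant rmorph_sum; apply: (val_ge_sum dw) => p _.
    rewrite rmorphM; apply: (val_geMl dw); first exact: VR.
    rewrite rmorph_prod subn1.
    by apply: (val_ge_prod dw) => k; rewrite !mxE; apply: Dmu.
  have det_mul_coef (j : 'I_e) : \det D * (x ^+ (e - 1 - j) * (- y) ^+ j) =
      \sum_i hb_map x y (row i D) * cofactor D i j.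
    have := congr1 (fun A : 'cV_e => A j 0) (mulmxA (\adj D) D (hb_column x y e)).
    rewrite mul_adj_mx mul_scalar_mx [RHS]mxE [hb_column _ _ _ _ _]mxE => <-.
    rewrite mxE; apply: eq_bigr => i _; rewrite mulrC [\adj _ _ _]mxE; congr (_ * _).
    by rewrite hb_map_row.
  have val_bound (j : 'I_e) : val_ge w (n + mu *+ (e - 1))
      (FracField.tofrac (\det D * (x ^+ (e - 1 - j) * (- y) ^+ j))).
    rewrite det_mul_coef rmorph_sum; apply: (val_ge_sum dw) => i _; rewrite rmorphM.
    apply: (val_geM dw); last exact: cof_mu.
    rewrite /val_ge /= tofrac_eq0; apply: wI.
    by rewrite -(mem_module xyP ab e_bounds a_e); apply: DM.
  have [_ wM _] := dw.
  have D0' : FracField.tofrac (\det D) != 0 by rewrite tofrac_eq0.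
  suff : n <= w (FracField.tofrac (\det D)) by rewrite leNgt wD.
  have [xy|/ltW yx] := leP (w (FracField.tofrac x)) (w (FracField.tofrac y)).
    have := val_bound k0; rewrite /= expr0 mulr1 subn0 rmorphM rmorphXn /= /val_ge /=.
    rewrite mulf_neq0 ?expf_neq0 ?tofrac_eq0 // => /(_ isT).
    rewrite wM ?expf_neq0 ?tofrac_eq0 // (discrete_valuationX dw) ?tofrac_eq0 //.
    by rewrite /mu (min_idPl xy) lerD2r.
  have := val_geMl dw (VR ((-1) ^+ (e - 1))) (val_bound k1).
  rewrite /= subnn expr0 mul1r -rmorphM /= [(- y) ^+ _]exprNn mulrCA signrMK.
  rewrite rmorphM rmorphXn /= /val_ge /=.
  rewrite mulf_neq0 ?expf_neq0 ?tofrac_eq0 // => /(_ isT).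
  rewrite wM ?expf_neq0 ?tofrac_eq0 // (discrete_valuationX dw) ?tofrac_eq0 //.
  by rewrite /mu (min_idPr yx) lerD2r.
move=> zI.
have [v [vM vz]] : exists v, v \in M /\ hb_map x y v = z.
  exact: (hb_map_surjective ab e_bounds a_e).
(* By Cramer's rule for the column of pi again, det D x^(e-1) = pi(v) x^(e-1). *)
pose D := \matrix_(i < e, k < e) (if i == 0%N :> nat then v 0 k else gen_g x y e i 0 k).
have rowD i : row i D = if i == 0%N :> nat then v else gen_g x y e i.
  by apply/rowP => k; rewrite [LHS]mxE [LHS]mxE; case: ifP.
have DM i : row i D \in M.
  rewrite rowD; case: ifP => // /negbT i0; apply: gen_g_mem; have := ltn_ord i; lia.
apply: mem_gen_ideal; exists D => //.
have cof00 : cofactor D k0 k0 = x ^+ (e - 1).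
  rewrite /cofactor addnn -mul2n muln0 expr0 mul1r det_trig.
    rewrite (eq_bigr (fun=> x)) ?prodr_const ?card_ord ?subn1 // => i _.
    rewrite !mxE /= /bump leq0n add1n /= !eqSS.
    have -> : (i.+1 == i) = false by lia.
    by rewrite eqxx /= mulr0n mulr1n mulr0 mulr1 add0r.
  apply/is_trig_mxP => i j ij; rewrite !mxE /= /bump !leq0n !add1n /= !eqSS.
  have -> : (j.+1 == i) = false by lia.
  have -> : (j == i :> nat) = false by lia.
  by rewrite /= mulr0n !mulr0 addr0.
have E : \det D * x ^+ (e - 1) = hb_map x y v * x ^+ (e - 1).
  have := congr1 (fun A : 'cV_e => A k0 0) (mulmxA (\adj D) D (hb_column x y e)).
  rewrite mul_adj_mx mul_scalar_mx [RHS]mxE [hb_column _ _ _ _ _]mxE /= subn0 expr0 mulr1 => <-.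
  rewrite mxE (bigD1 k0) //= big1 ?addr0 => [|i ik].
    rewrite [\adj _ _ _]mxE cof00 mulrC; congr (_ * _).
    have -> : (D *m hb_column x y e) k0 0 = hb_map x y (row k0 D) by rewrite hb_map_row.
    by rewrite rowD.
  have -> : (D *m hb_column x y e) i 0 = hb_map x y (row i D) by rewrite hb_map_row.
  rewrite rowD; have -> : (i == 0%N :> nat) = false.
    by apply: contraNF ik => /eqP i0; apply/eqP/val_inj.
  rewrite hb_map_g ?mulr0 //; have := ltn_ord i; move: ik; rewrite -val_eqE /=; lia.
have x0' : x ^+ (e - 1) != 0 by rewrite expf_neq0.
by rewrite (mulIf x0' E) vz.
Qed.

End Shape.

(** * Indecomposability *)

Section Indecomposable.
Context (R : idomainType) (x y : R) (xyP : parameters x y) (r e : nat) (a b : nat -> nat)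
  (ab : staircase r a b) (e_bounds : (2 <= e <= r)%N) (a_e : a (r - e + 2)%N = (e - 2)%N).
Local Notation I := (monomial_ideal x y a b r).
Local Notation M := (monomial_module x y a b r e).

Context (M_shape : forall v, v \in M -> pencil_shape x y v).

(** The projection onto a summand, extended coordinatewise to R^e, is an idempotent
    matrix mapping each g_i into M. *)
Lemma module_indecomposable : indecomposable M.
Proof.
have [x0 _] := param_neq0 xyP.
have xM := x_power_mem xyP ab e_bounds a_e; have yM := y_power_mem xyP ab e_bounds a_e.
have xa0 : x ^+ a 0%N != 0 by rewrite expf_neq0.
have e0 : (0 < e)%N by lia.
split.
  exists (x ^+ a 0%N *: delta_mx 0 (Ordinal e0)); first exact: xM.
  apply/eqP => /rowP /(_ (Ordinal e0)); rewrite !mxE !eqxx mulr1.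
  exact/eqP.
move=> A B AM BM AB_sum AB0.
pose MM := submod_type M.
have /choice [p pP] (s : MM) : exists u, u \in A /\ val s - u \in B.
  have [u [w [uA wB ->]]] := AB_sum (val s) (submod_valP s).
  by exists u; rewrite addrC addrA addNr add0r.
have p_unique (s : MM) u : u \in A -> val s - u \in B -> p s = u.
  move=> uA uB; have [pA pB] := pP s; apply/eqP; rewrite -subr_eq0; apply/eqP/AB0.
    exact: submodB.
  have -> : p s - u = (val s - u) - (val s - p s) by rewrite opprB [RHS]addrC addrA addrNK.
  exact: submodB.
have p_lin c s t : p (c *: s + t) = c *: p s + p t.
  have [psA psB] := pP s; have [ptA ptB] := pP t.
  apply: p_unique; first by rewrite rpredD ?rpredZ.
  have -> : val (c *: s + t) - (c *: p s + p t) = c *: (val s - p s) + (val t - p t).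
    by rewrite /= scalerBr opprD addrACA.
  by rewrite rpredD ?rpredZ.
have /choice [col colP] k : exists c : 'cV[R]_e, forall s, p s 0 k = (val s *m c) 0 0.
  apply: (linear_form_extends xyP xM yM (f := fun s => p s 0 k)) => c s t.
  by rewrite p_lin !mxE.
pose phi := \matrix_(i, j) col j i 0.
have phiP (s : MM) : val s *m phi = p s.
  by apply/rowP => k; rewrite colP !mxE; apply: eq_bigr => i _; rewrite !mxE.
have phi_mem v : v \in M -> v *m phi \in A /\ v - v *m phi \in B.
  by move=> vM; have := pP (SubmodType vM); rewrite -phiP.
have phiA v : v \in A -> v *m phi = v.
  move=> vA; rewrite (phiP (SubmodType (AM v vA))); apply: p_unique => //=.
  by rewrite subrr rpred0.
have phiB v : v \in B -> v *m phi = 0.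
  move=> vB; rewrite (phiP (SubmodType (BM v vB))); apply: p_unique; first exact: rpred0.
  by rewrite subr0.
have phi2 : phi *m phi = phi.
  apply/matrixP => i k; apply: (mulfI xa0).
  have /rowP /(_ k) : x ^+ a 0%N *: row i (phi *m phi) = x ^+ a 0%N *: row i phi.
    rewrite !rowE !scalemxAl mulmxA.
    by apply: phiA; case: (phi_mem _ (xM (delta_mx 0 i))).
  by rewrite [LHS]mxE [RHS]mxE [X in _ * X]mxE [X in _ = _ * X -> _]mxE.
have [|phi0|phi1] := idempotent_trivial xyP e0 phi2.
- move=> i ie; apply: M_shape; apply: AM.
  by case: (phi_mem (gen_g x y e i)) => //; apply: gen_g_mem.
- by left=> v /phiA; rewrite phi0 mulmx0 => <-.
- by right=> v /phiB; rewrite phi1 mulmx1.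
Qed.

End Indecomposable.

(** * Orders of the generators *)

Section Orders.
Context (R : idomainType) (x y : R) (xyP : parameters x y) (r e : nat) (a b : nat -> nat)
  (ab : staircase r a b) (e_bounds : (2 <= e <= r)%N) (a_e : a (r - e + 2)%N = (e - 2)%N).
Local Notation I := (monomial_ideal x y a b r).

(** In the first case a_1 > e - 1, b_i >= i and b_(r-e+1+i) >= i + 2, by strict
    monotonicity of the exponents.  In the second case x^r in I forces a_0 = r and
    a_1 = r - 1, so x^(r-1) y not in I excludes b_1 = 1; all later b_i exceed i as well. *)
Lemma generator_orders :
  (e + 1 <= r)%N \/ [/\ r = e, x ^+ (r - 1) * y \notin I & x ^+ r \in I] ->
  [/\ (0 < aprime a e 0)%N,
      forall i, (1 <= i <= r - e + 1)%N -> (2 <= aprime a e i + b i)%N &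
      forall i, (1 <= i <= e - 1)%N -> (2 <= cexp b r e i)%N].
Proof.
have head := head_exponent ab e_bounds a_e.
have b_gap := increasing_gap (staircase_incr ab).
have f0 : (0 < aprime a e 0)%N by have := head 0%N isT; rewrite /aprime; lia.
case=> [er|[re xyI xI]].
  split=> // i ie; first by have := head i; have := b_gap 0%N i; rewrite /aprime; lia.
  by have := b_gap 0%N (r - e + 1 + i)%N; rewrite /cexp; lia.
have a0r : (a 0%N <= r)%N.
  have [] := unit_monomial_mem xyP (mu := (r, 0%N)) (unitr1 R)
    (S := [set (a i, b i) | i in [set i | (i <= r)%N]]).
    by rewrite mul1r /monomial /= mulr1 -monomial_idealE.
  move=> _ [[i /= ir <-] /= ai bi].
  have i0 : i = 0%N by have := b_gap 0%N i; lia.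
  by rewrite -i0.
have a1 : a 1%N = (r - 1)%N.
  have := staircase_decr ab (i := 0%N); have := head 1%N; lia.
have b1 : (2 <= b 1%N)%N.
  have b1_neq : b 1%N != 1%N.
    apply: contraNneq xyI => b1; apply: mem_gen_ideal.
    by exists 1%N; rewrite /= ?a1 ?b1 //; lia.
  by have := b_gap 0%N 1%N; lia.
split=> // i ie; first by have -> : i = 1%N; lia.
by have := b_gap 1%N (r - e + 1 + i)%N; rewrite /cexp; lia.
Qed.

End Orders.

Theorem theorem6p1 (R : idomainType) (m : idealr R) (x y : R)
    (regR : regular_local_ring2 m x y) (infk : infinite_residue_field m)
    (r e : nat) (a b : nat -> nat)
    (r_ge2 : (2 <= r)%N)
    (a_decr : forall i, (i < r)%N -> (a i.+1 < a i)%N) (a_r : a r = 0%N)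
    (b_0 : b 0%N = 0%N) (b_incr : forall i, (i < r)%N -> (b i < b i.+1)%N)
    (a0_le_br : (a 0%N <= b r)%N)
    (I_complete : complete_ideal (monomial_ideal x y a b r))
    (e_bounds : (2 <= e <= r)%N)
    (a_e : a (r - e + 2)%N = (e - 2)%N)
    (cases : (e + 1 <= r)%N \/
       [/\ r = e, x ^+ (r - 1) * y \notin monomial_ideal x y a b r
         & x ^+ r \in monomial_ideal x y a b r]) :
  let I := monomial_ideal x y a b r in
  let M := monomial_module x y a b r e in
  [/\ indecomposable M, integrally_closed M, has_rank M e
    & module_ideal (submod_type M) = [set` I]].
Proof.
move=> I M.
have xyP := regular_parameters regR.
have ab : staircase r a b by split.
have [f0 f_ord h_ord] := generator_orders xyP ab e_bounds a_e cases.
have M_shape := module_pencil_shape xyP ab e_bounds a_e f0 f_ord h_ord.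
split.
- exact: (module_indecomposable xyP ab e_bounds a_e M_shape).
- exact: (module_integrally_closed xyP ab e_bounds a_e I_complete).
- exact: (module_has_rank xyP ab e_bounds a_e).
- rewrite (module_ideal_minors xyP (x_power_mem xyP ab e_bounds a_e)
    (y_power_mem xyP ab e_bounds a_e)).
  exact: (minors_ideal_module xyP ab e_bounds a_e f0 f_ord h_ord I_complete).
Qed.
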